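(* Consider a planar resonant set $(\mathcal{R},l)$ with quadratic growth, an approximation function $\psi$ and a dimension function $f$ such that the function $l\mapsto l\cdot f(\psi(l))$, for $l>0$, is decreasing monotone. (1) If $\sum_{n=1}^\infty n f(\psi(n))<\infty$, then $H^f\big(W(\mathcal{R},\psi)\big)=0$. (2) If $\sum_{n=1}^\infty n f(\psi(n))=\infty$ and if moreover $(\mathcal{R},l)$ is ubiquitous and has isotropic quadratic growth, then $H^f\big(W(\mathcal{R},\psi)\big)=H^f\big([-\pi/2,\pi/2[\big)$.
   Context: Directions are points of $[-\pi/2,\pi/2[$ (endpoints identified). $B(\theta,r)$ is the open subinterval of $[-\pi/2,\pi/2[$ of length $2r$ centered at $\theta$; ''interval'' means subinterval of $[-\pi/2,\pi/2[$; $|E|$ is Lebesgue measure. A planar resonant set $(\mathcal{R},l)$ is a countable subset $\mathcal{R}\subset[-\pi/2,\pi/2[$ with a positive function $l:\mathcal{R}\to\mathbb{R}_+$ such that $\{\theta\in\mathcal{R}: l(\theta)<L\}$ is finite for any $L>0$. An approximation function is a decreasing function $\psi:\mathbb{R}_+\to\mathbb{R}_+$, and $W(\mathcal{R},\psi):=\bigcap_{L>0}\bigcup_{\theta\in\mathcal{R},\,l(\theta)>L}B(\theta,\psi(l(\theta)))$. Quadratic growth: there is $M>0$ such that $\sharp\{\theta\in\mathcal{R}: l(\theta)\leq R\}\leq M R^2$ for any $R>0$. Isotropic quadratic growth: there is $M>0$ such that $\sharp\{\theta\in I\cap\mathcal{R}: l(\theta)\leq R\}\leq M|I|R^2$ for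 any interval $I$ and any $R>0$ with $R^2|I|\geq 1$. Ubiquity: for any $K>1$ big enough there exist $c_1>0$, $c_2>0$, $a>0$ (depending on $K$), with $a/c_1=o(K^2)$ as $K\to\infty$, such that for any $n$ and any interval $I$ with $|I|\geq c_2/K^n$ we have $\big|I\cap\bigcup_{l(\theta)\leq K^n}B(\theta,a/K^{2n})\big|\geq c_1|I|$. A dimension function is a continuous increasing function $f:\mathbb{R}_+\to\mathbb{R}_+$ such that either $f(r)/r$ is decreasing with $\lim_{r\to0}f(r)/r=\infty$, or $f(r)=r$. The Hausdorff $f$-measure is $H^f(E)=\lim_{\rho\to0}\inf\sum_i f(|B_i|)$, the infimum being over countable covers of $E$ by intervals $B_i$ of length $|B_i|\leq\rho$. *)

(* Defs.v *)
From HB Require Import structures.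
From mathcomp Require Import all_boot all_order all_algebra.
From mathcomp Require Import all_classical all_reals all_analysis.
Set Implicit Arguments.
Unset Strict Implicit.
Unset Printing Implicit Defensive.
Import Order.TTheory GRing.Theory Num.Theory.
Import numFieldNormedType.Exports.
Local Open Scope classical_set_scope.
Local Open Scope ring_scope.

Section PlanarResonantSets.
Context {R : realType}.
Implicit Types (S E I : set R) (l psi f : R -> R).

Definition directions : set R := `[- (pi / 2), pi / 2[.

Definition direction_interval I : Prop := is_interval I /\ I `<=` directions.

(* |E|, as a real number; only used for subsets of [directions], on which
   the Lebesgue measure is finite. *)
Definition len E : R := fine (lebesgue_measure E).

(* The endpoints of [directions] being identified, the ball is taken on the
   circle R / pi Z: near the endpoints it wraps around, and for 2 r > pi it is
   the whole circle. It is empty for r <= 0. *)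
Definition direction_ball (t r : R) : set R :=
  directions `&` [set x | exists k : int, `|x - t - k%:~R * pi| < r].

(* [l] is a total function on R, but only its values on [S] matter. *)
Record planar_resonant_set S l : Prop := PlanarResonantSet {
  resonant_directions : S `<=` directions ;
  resonant_countable : countable S ;
  resonant_length_gt0 : forall t, S t -> 0 < l t ;
  resonant_finite : forall L : R, 0 < L -> finite_set [set t | S t /\ l t < L]
}.

(* The domain of psi is ]0, +oo[, so that psi may be unbounded near 0 (as for
   psi(r) = r ^- 2); monotonicity is understood in the wide sense. *)
Record approximation_function psi : Prop := ApproximationFunction {
  approximation_ge0 : forall r : R, 0 < r -> 0 <= psi r ;
  approximation_decreasing : forall r s : R, 0 < r -> r <= s -> psi s <= psi r
}.

(* theta \in W(S, psi) iff theta lies in infinitely many of the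
   B(t, psi(l(t))), in the sense of arbitrarily large l(t) *)
Definition limsup_set S l psi : set R :=
  \bigcap_(L in [set L : R | 0 < L])
    \bigcup_(t in [set t | S t /\ L < l t]) direction_ball t (psi (l t)).

Definition quadratic_growth S l : Prop :=
  exists2 M : R, 0 < M &
    forall r : R, 0 < r ->
      (counting [set t | S t /\ (l t <= r)%R] <= (M * r ^+ 2)%:E)%E.

Definition isotropic_quadratic_growth S l : Prop :=
  exists2 M : R, 0 < M &
    forall I (r : R), direction_interval I -> 0 < r -> 1 <= r ^+ 2 * len I ->
      (counting [set t | (I `&` S) t /\ (l t <= r)%R]
         <= (M * len I * r ^+ 2)%:E)%E.

(* The constants depend on K (but not on n), hence are functions of K; the
   last clause is a / c1 = o(K ^ 2). *)
Definition ubiquitous S l : Prop :=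
  exists c1 c2 a : R -> R,
    (\forall K \near +oo,
       [/\ 0 < c1 K, 0 < c2 K, 0 < a K &
        forall (n : nat) I, direction_interval I -> c2 K / K ^+ n <= len I ->
          c1 K * len I <=
          len (I `&` \bigcup_(t in [set t | S t /\ l t <= K ^+ n])
                       direction_ball t (a K / K ^+ (2 * n)))]) /\
    a K / c1 K / K ^+ 2 @[K --> +oo] --> 0.

(* Here the domain of f is [0, +oo[. *)
Record dimension_function f : Prop := DimensionFunction {
  dimension_ge0 : forall r : R, 0 <= r -> 0 <= f r ;
  dimension_continuous : {within `[0, +oo[, continuous f} ;
  dimension_increasing : forall r s : R, 0 <= r -> r <= s -> f r <= f s ;
  dimension_growth :
    ((forall r s : R, 0 < r -> r <= s -> f s / s <= f r / r) /\
     f r / r @[r --> 0^'+] --> +oo)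
    \/ (forall r : R, 0 <= r -> f r = r)
}.

(* [D] is the (finite or infinite) index set of the cover. *)
Definition interval_cover E (rho : R) (D : set nat) (B : nat -> set R) : Prop :=
  (forall i, D i -> direction_interval (B i) /\ len (B i) <= rho) /\
  E `<=` \bigcup_(i in D) B i.

Definition hausdorff_content f (rho : R) E : \bar R :=
  ereal_inf [set s | exists D B, interval_cover E rho D B /\
                       s = (\esum_(i in D) (f (len (B i)))%:E)%E].

Definition hausdorff_measure f E : \bar R :=
  lim (hausdorff_content f rho E @[rho --> 0^'+]).

End PlanarResonantSets.

(* Main.v *)
(* Convergence: W is covered by the balls of large length, and quadratic growth
   together with Cauchy condensation makes the tail of the sum of f (psi (l t))
   small.

   Divergence: put phi := f \o psi. Ubiquity says that the resonances of length
   at most K^n equidistribute at scale K^(-2n); since a / c1 = o(K^2), isotropic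
   growth makes the resonances of length at most K^(n-1), as well as the balls
   already chosen around them, negligible at this scale. A greedy choice along
   n, which can only stop once a fixed proportion kappa of the interval is
   filled because the sum of n phi(n) diverges, then produces in every interval
   finitely many disjoint balls B(t, r), r <= phi (l t), of total length at
   least kappa times that of the interval.
   If f(r) = r, the Lebesgue density theorem shows that W has full measure.
   If f(r) / r tends to infinity, the measure of W is infinite, which is a mass
   transference argument without a measure: several generations of such balls
   are put in an interval J, each shrunk to a ball of radius rho <= psi (l t)
   with f (2 rho) >= r, so that the shrunken balls are disjoint although the
   large ones cover J many times. Given a cover of small f-sum, averaging over
   these balls finds one that meets only small sets of the cover, of small
   f-sum again; iterating yields a point of W outside the cover. *)
Require Import Defs.
From HB Require Import structures.
From mathcomp Require Import all_boot all_order all_algebra.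
From mathcomp Require Import all_classical all_reals all_analysis.
From mathcomp Require Import ring lra zify.
Set Implicit Arguments.
Unset Strict Implicit.
Unset Printing Implicit Defensive.
Import Order.TTheory GRing.Theory Num.Theory.
Import numFieldNormedType.Exports.
Local Open Scope classical_set_scope.
Local Open Scope ring_scope.

(** * Families of intervals *)

Section Families.
Context {R : realType}.
Implicit Types (F : seq (R * R)) (X : set R).

(** A pair stands for the interval of centre [u.1] and radius [u.2]; the strict inequality makes
    even the closed intervals disjoint. *)
Definition separated (u v : R * R) : bool := u.2 + v.2 < `|u.1 - v.1|.

Lemma lebesgue_measure_oo (a b : R) : a <= b ->
  lebesgue_measure (`]a, b[%classic : set R) = (b - a)%:E.
Proof.
move=> ab; have -> := @lebesgue_measure_itv R `]a, b[ => /=.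
rewrite lte_fin; case: ifPn => //; rewrite -leNgt => ba.
by rewrite (_ : b = a) ?subrr//; apply/eqP; rewrite eq_le ab ba.
Qed.

Lemma lebesgue_measure_cc (a b : R) : a <= b ->
  lebesgue_measure (`[a, b]%classic : set R) = (b - a)%:E.
Proof.
move=> ab; have -> := @lebesgue_measure_itv R `[a, b] => /=.
rewrite lte_fin; case: ifPn => //; rewrite -leNgt => ba.
by rewrite (_ : b = a) ?subrr//; apply/eqP; rewrite eq_le ab ba.
Qed.

Lemma lebesgue_measureDI X Y : measurable X -> measurable Y ->
  lebesgue_measure X =
    (lebesgue_measure (X `\` Y) + lebesgue_measure (X `&` Y))%E.
Proof. by move=> mX mY; exact: measureDI. Qed.

Lemma lebesgue_measure_packing X F : measurable X -> pairwise separated F ->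
  (forall u, u \in F -> 0 <= u.2 /\ `]u.1 - u.2, u.1 + u.2[ `<=` X) ->
  ((\sum_(u <- F) 2 * u.2)%:E <= lebesgue_measure X)%E.
Proof.
elim: F X => [|u F IH] X mX /=; first by rewrite big_nil.
move=> /andP[/allP uF sF] FX.
have mu : measurable (`]u.1 - u.2, u.1 + u.2[%classic : set R) by exact: measurable_itv.
have [u0 uX] := FX u (mem_head _ _).
rewrite big_cons (lebesgue_measureDI mX mu) EFinD addeC; apply: leeD.
  apply: IH => //; first exact: measurableD.
  move=> v vF; have [v0 vX] := FX v (mem_behead (s := u :: F) vF).
  split => // x /= xv; split; first exact: vX.
  move: (uF v vF); rewrite /separated.
  move: xv; rewrite /= !in_itv /= => /andP[h1 h2] h3 /andP[h4 h5].
  move: h3; rewrite ltNge => /negP; apply; rewrite ler_norml; apply/andP.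
  by split; lra.
rewrite setIidr// lebesgue_measure_oo ?lee_fin; lra.
Qed.

Lemma sum_radii_packing F (a b : R) : a <= b -> pairwise separated F ->
  (forall u, u \in F -> [/\ 0 <= u.2, a <= u.1 - u.2 & u.1 + u.2 <= b]) ->
  \sum_(u <- F) 2 * u.2 <= b - a.
Proof.
move=> ab sF Fab.
rewrite -lee_fin -(lebesgue_measure_cc ab).
apply: (@lebesgue_measure_packing `[a, b]%classic F) => //.
move=> u /Fab[u0 au ub]; split => // x; rewrite /= !in_itv/= => /andP[h1 h2].
by apply/andP; split; lra.
Qed.

Lemma lebesgue_measure_cover X F : measurable X ->
  (forall u, u \in F -> 0 <= u.2) ->
  (forall x, X x -> exists2 u, u \in F & `|x - u.1| <= u.2) ->
  (lebesgue_measure X <= (\sum_(u <- F) 2 * u.2)%:E)%E.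
Proof.
elim: F X => [|u F IH] X mX F0 XF.
  rewrite big_nil; have -> : X = set0; last by rewrite measure0.
  by apply/seteqP; split => // x /XF[].
have mu : measurable (`[u.1 - u.2, u.1 + u.2]%classic : set R) by exact: measurable_itv.
rewrite big_cons (lebesgue_measureDI mX mu) EFinD [leLHS]addeC; apply: leeD.
  apply: (@le_trans _ _ (lebesgue_measure `[u.1 - u.2, u.1 + u.2])).
    by apply: le_measure; rewrite ?inE; [exact: measurableI|exact: mu|exact: subIsetr].
  have := F0 u (mem_head _ _).
  by move=> u0; rewrite lebesgue_measure_cc ?lee_fin; lra.
apply: IH => [|v vF|x [/XF[v]]]; first exact: measurableD.
  by apply: F0; rewrite inE vF orbT.
rewrite inE => /predU1P[->|vF xv _]; last by exists v.
rewrite ler_norml => /andP[h1 h2]; rewrite /= in_itv /= => -[]; apply/andP.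
by split; lra.
Qed.

(** A point is kept if it is far from those already kept. The absolute value covers negative [d],
    for which every point is kept. *)
Lemma maximal_separated (d : R) (s : seq R) :
  exists t : seq R, [/\ {subset t <= s}, pairwise (fun x y => d < `|x - y|) t &
    forall x, x \in s -> exists2 y, y \in t & `|x - y| <= `|d|].
Proof.
elim: s => [|x s [t [ts pt st]]]; first by exists [::].
have [h|/allPn /= [y yt xy]] := boolP (all (fun y => d < `|x - y|) t).
  exists (x :: t); split => [y||y].
  - by rewrite !inE => /predU1P[->|/ts->]; rewrite ?eqxx ?orbT.
  - by rewrite /= h.
  - rewrite inE => /predU1P[->|/st[z zt yz]].
      by exists x; rewrite ?mem_head// subrr normr0.
    by exists z; rewrite // inE zt orbT.
exists t; split => [z /ts zs||z]; rewrite ?inE ?zs ?orbT//.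
move=> /predU1P[->|/st//]; exists y => //.
by rewrite (le_trans _ (ler_norm d))// leNgt.
Qed.

Lemma size_le_counting (A : set R) (s : seq R) (c : R) : uniq s ->
  (forall x, x \in s -> A x) -> (counting A <= c%:E)%E -> (size s)%:R <= c.
Proof.
move=> us sA; rewrite /counting; case: ifPn => [/asboolP fA|]; last by rewrite leye_eq.
rewrite lee_fin; apply: le_trans; rewrite ler_nat.
apply: uniq_leq_size => // x /sA Ax.
by have := in_fset_set fA x; rewrite (mem_set Ax).
Qed.

Lemma pairwise_sym_mem (T : eqType) (r : rel T) (s : seq T) : symmetric r ->
  pairwise r s -> forall u v, u \in s -> v \in s -> u != v -> r u v.
Proof.
move=> sr; elim: s => //= x s IH /andP[/allP xs ps] u v.
rewrite !inE => /predU1P[->|us] /predU1P[->|vs]; rewrite ?eqxx// => uv.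
- exact: xs.
- by rewrite sr; exact: xs.
- exact: IH.
Qed.

Lemma separated_uniq F : (forall u, u \in F -> 0 <= u.2) ->
  pairwise separated F -> uniq [seq u.1 | u <- F].
Proof.
elim: F => //= u F IH F0 /andP[/allP uF pF]; apply/andP; split.
  apply/mapP => -[v vF uv]; have := uF v vF; rewrite /separated uv subrr normr0 ltNge.
  by rewrite addr_ge0// F0// ?mem_head// inE vF orbT.
by apply: IH => // v vF; apply: F0; rewrite inE vF orbT.
Qed.

End Families.

(** * New resonances at a given level *)

Section Level.
Context {R : realType}.
Implicit Types (S : set R) (l : R -> R).

Lemma sumr_const_seq (T : Type) (s : seq T) (c : R) :
  \sum_(x <- s) c = (size s)%:R * c.
Proof.
elim: s => [|x s IH]; first by rewrite big_nil mul0r.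
by rewrite big_cons IH /= mulrSr mulrDl mul1r addrC.
Qed.

Lemma is_interval_itv_sub (a b : R) : - (pi / 2) <= a -> b < pi / 2 ->
  direction_interval `[a, b].
Proof.
move=> ha hb; split; first exact: interval_is_interval.
by move=> x; rewrite /directions /= !in_itv /= => /andP[h1 h2]; apply/andP; split; lra.
Qed.

Lemma direction_ballE (t r : R) : direction_ball t r =
  directions `&` \bigcup_(k in [set: int]) ball (t + k%:~R * pi) r.
Proof.
rewrite /direction_ball; congr (_ `&` _); apply/seteqP; split => x /=.
  by move=> [k kx]; exists k => //; rewrite /ball /= distrC opprD addrA.
by move=> [k _]; rewrite /ball /= distrC opprD addrA => kx; exists k.
Qed.

Lemma measurable_direction_ball (t r : R) : measurable (direction_ball t r).
Proof.
rewrite direction_ballE; apply: measurableI; first exact: measurable_itv.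
apply: measurable_realfun.open_measurable; apply: bigcup_open => k _; exact: ball_open.
Qed.

(** A centre [t + k * pi] with [k] nonzero is at distance at least [h] from [x], so wrapping around
    has no effect there. *)
Lemma direction_ball_far_from_ends (t r x h : R) : directions t -> r <= h ->
  - (pi / 2) + h <= x <= pi / 2 - h -> direction_ball t r x -> `|x - t| < r.
Proof.
rewrite /directions /= in_itv /= => /andP[t1 t2] rh /andP[x1 x2] [_ [k]].
have pi0 := pi_gt0 R.
case: k => [[|k]|k]; first by rewrite mul0r subr0.
  rewrite -pmulrn (natrD _ 1%N k) mulrDl mul1r; have : 0 <= k%:R * (pi : R) by rewrite mulr_ge0// pi_ge0.
  by rewrite ltr_norml => k0 /andP[k1 k2]; exfalso; lra.
rewrite NegzE mulrNz -pmulrn (natrD _ 1%N k) mulNr mulrDl mul1r.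
have : 0 <= k%:R * (pi : R) by rewrite mulr_ge0// pi_ge0.
by rewrite ltr_norml => k0 /andP[k1 k2]; exfalso; lra.
Qed.

Lemma direction_ball_near (t r x : R) : directions x -> `|x - t| < r -> direction_ball t r x.
Proof. by move=> dx xt; split => //; exists 0; rewrite mul0r subr0. Qed.

Lemma finite_resonances S l (L : R) : planar_resonant_set S l ->
  finite_set [set t | S t /\ l t <= L].
Proof.
move=> resS; apply: sub_finite_set (resonant_finite resS (ltr_pwDr ltr01 (normr_ge0 L))).
move=> t [St lt]; split => //; apply: le_lt_trans lt _.
by rewrite (le_lt_trans (ler_norm L))// ltrDl.
Qed.

(* The points of [G] are new resonances of length in ]A, B]: the old ones
   cannot account for the measure given by ubiquity. *)
Lemma new_resonances S l (A B N c al h d : R) (F : seq (R * R)) :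
  planar_resonant_set S l -> 0 < h -> - (pi / 2) <= al -> al + 8 * h <= pi / 2 ->
  0 < d -> d <= h -> A <= B ->
  (forall s : seq R, uniq s ->
    (forall t, t \in s -> [/\ S t, al + h <= t <= al + 7 * h & l t <= A]) ->
    (size s)%:R <= N) ->
  c * (4 * h) <= len (`[(al + 2 * h)%R, (al + 6 * h)%R] `&`
      \bigcup_(t in [set t | S t /\ l t <= B]) direction_ball t d) ->
  8 * d * N <= c * h ->
  pairwise separated F ->
  (forall u, u \in F -> [/\ 0 <= u.2, S u.1, al + h <= u.1 <= al + 7 * h & l u.1 <= A]) ->
  \sum_(u <- F) u.2 <= c * h ->
  exists G : seq R, [/\ pairwise (fun x y => 2 * d < `|x - y|) G,
    forall x, x \in G -> [/\ S x, A < l x <= B, al + h <= x <= al + 7 * h &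
      forall u, u \in F -> u.2 + 2 * d < `|x - u.1|] &
    c * h <= 6 * d * (size G)%:R].
Proof.
move=> resS h0 alpi hpi d0 dh AB cnt ubi dN sF FP sumF.
pose T := [set t | S t /\ l t <= B] `&` [set t | al + h <= t <= al + 7 * h].
have /finite_seqP[s0 Ts0] : finite_set T.
  by apply: sub_finite_set (finite_resonances B resS) => t [].
have Ts x : (x \in undup s0) = `[< T x >].
  by rewrite mem_undup Ts0; apply/idP/asboolP.
pose s := undup s0; have us : uniq s by exact: undup_uniq.
pose low := [seq t <- s | l t <= A].
pose new := [seq t <- s | (A < l t) && all (fun u : R * R => u.2 + 2 * d < `|t - u.1|) F].
have [G [Gnew pG Gmax]] := maximal_separated (2 * d) new.
exists G; split => // [x /Gnew|].
  rewrite mem_filter Ts => /andP[/andP[Ax /allP xF] /asboolP[[Sx lx] xh]].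
  by rewrite Ax lx; split => // u /xF.
have sizelow : (size low)%:R <= N.
  apply: cnt; first exact: filter_uniq.
  by move=> t; rewrite mem_filter Ts => /andP[lt /asboolP[[St _] th]].
(* Separated balls have distinct centres, and these are old resonances, so [N] bounds their number
   too. *)
have sizeF : (size F)%:R <= N.
  rewrite -(size_map (fun u => u.1)); apply: cnt.
    by apply: separated_uniq sF => u /FP[].
  by move=> t /mapP[u /FP[? ? ? ?] ->].
(* A resonance contributing to [X] is old, or new but close to a ball of [F], or new and within
   [2 * d] of a point of [G]. Adding the ball radius [d] turns the thresholds [2 * d] into
   [3 * d]. *)
pose Cov := [seq (t, d) | t <- low] ++ [seq (u.1, u.2 + 3 * d) | u <- F] ++
  [seq (t, 3 * d) | t <- G].
have Cov0 u : u \in Cov -> 0 <= u.2.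
  rewrite !mem_cat => /or3P[/mapP[t _ ->]|/mapP[v /FP[v0 _ _ _] ->]|/mapP[t _ ->]] /=; lra.
set X := (X in len X) in ubi.
have mX : measurable X.
  apply: measurableI; first exact: measurable_itv.
  apply: fin_bigcup_measurable => [|t _]; first exact: finite_resonances.
  exact: measurable_direction_ball.
have Xcov x : X x -> exists2 u, u \in Cov & `|x - u.1| <= u.2.
  move=> [/=]; rewrite in_itv /= => /andP[x1 x2] [t [St lt] tx].
  have xt : `|x - t| < d.
    apply: (direction_ball_far_from_ends (h := h)) tx => //; last by apply/andP; split; lra.
    exact: resonant_directions resS _ St.
  have ts : t \in s.
    rewrite Ts; apply/asboolP; split => //=; move: xt; rewrite ltr_norml => /andP[? ?].
    by apply/andP; split; lra.
  have [lA|Al] := leP (l t) A.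
    exists (t, d); last exact: ltW.
    by rewrite mem_cat map_f// mem_filter lA.
  have [tF|/allPn[u uF]] := boolP (all (fun u : R * R => u.2 + 2 * d < `|t - u.1|) F).
    have [|y yG ty] := Gmax t; first by rewrite mem_filter Al tF.
    exists (y, 3 * d); first by rewrite !mem_cat map_f ?orbT.
    rewrite /= (le_trans (ler_distD t _ _))//.
    move: ty; rewrite [leRHS]ger0_norm; lra.
  rewrite -leNgt => tu; exists (u.1, u.2 + 3 * d).
    by rewrite !mem_cat; apply/or3P/Or32/mapP; exists u.
  rewrite /= (le_trans (ler_distD t _ _))//; lra.
have /= := lebesgue_measure_cover mX Cov0 Xcov.
rewrite !big_cat/= !big_map /= => mXle.
have : len X <= \sum_(j <- low) 2 * d + (\sum_(j <- F) 2 * (j.2 + 3 * d) +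
    \sum_(j <- G) 2 * (3 * d)).
  have mX0 : (0 <= lebesgue_measure X)%E by [].
  rewrite -lee_fin /len fineK// ge0_fin_numE//; exact: le_lt_trans mXle (ltry _).
under [in X in _ + (X + _)]eq_bigr do rewrite mulrDr.
rewrite big_split /= -!mulr_sumr !sumr_const_seq => hX.
(* [F] and the old resonances cover at most [8 * d * N + 2 * c * h <= 3 * c * h], whereas [X] has
   measure at least [4 * c * h]; the balls around [G] cover the rest. *)
have : (size low)%:R * (2 * d) <= N * (2 * d) by apply: ler_wpM2r => //; lra.
have : (size F)%:R * (2 * (3 * d)) <= N * (2 * (3 * d)) by apply: ler_wpM2r => //; lra.
lra.
Qed.

End Level.

(** * Condensation *)

Section Greedy.
Context {R : realType}.
Implicit Types (S : set R) (l phi : R -> R).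

(** The parameter is taken to be a natural number so that its powers can serve as block ends when
    the series is condensed. *)
Lemma ubiquity_constants S l (e : R) : ubiquitous S l -> 0 < e ->
  exists (K : nat) (c1 c2 a : R),
    [/\ (1 < K)%N, 0 < c1, 0 < c2, 0 < a & a / c1 / K%:R ^+ 2 <= e] /\
    forall (n : nat) I, direction_interval I -> c2 / K%:R ^+ n <= len I ->
      c1 * len I <=
      len (I `&` \bigcup_(t in [set t | S t /\ l t <= K%:R ^+ n])
                   direction_ball t (a / K%:R ^+ (2 * n))).
Proof.
move=> [c1 [c2 [a [ubi lim0]]]] e0.
have lime : \forall K \near +oo, a K / c1 K / K ^+ 2 < e.
  exact: (cvgr_lt 0 lim0).
have [K0 [K0r HK]] := filterI ubi lime.
pose K := (Num.truncn (Num.max K0 1)).+1.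
have KK : Num.max K0 1 < K%:R by exact: truncnS_gt.
have [] := HK K%:R; first by rewrite (le_lt_trans _ KK)// le_max lexx.
move=> [c10 c20 a0 H] /ltW ae; exists K, (c1 K%:R), (c2 K%:R), (a K%:R).
split; last exact: H.
split => //; rewrite -(ltr_nat R) (le_lt_trans _ KK)// le_max lexx ?orbT//.
Qed.

Lemma condensation_block phi (K m : nat) : (1 < K)%N ->
  (forall r : R, 0 < r -> 0 <= phi r) ->
  (forall r s : R, 0 < r -> r <= s -> phi s <= phi r) ->
  \sum_(K ^ m <= n < K ^ m.+1) n%:R * phi n%:R <=
  K%:R ^+ 2 * (K%:R ^+ (2 * m) * phi (K%:R ^+ m)).
Proof.
move=> K1 phi0 phid.
have Km0 : 0 < K%:R ^+ m :> R by rewrite exprn_gt0// ltr0n ltnW.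
apply: (@le_trans _ _ (\sum_(K ^ m <= n < K ^ m.+1) K%:R ^+ m.+1 * phi (K%:R ^+ m))).
  apply: ler_sum_nat => n /andP[n1 n2].
  have n0 : 0 < n%:R :> R by rewrite (lt_le_trans Km0)// -natrX ler_nat.
  apply: ler_pM => //; first exact/phi0.
    by rewrite -natrX ler_nat ltnW.
  by apply: phid => //; rewrite -natrX ler_nat.
rewrite sumr_const_nat -[leLHS]mulr_natr mulrAC.
have -> : K%:R ^+ 2 * (K%:R ^+ (2 * m) * phi (K%:R ^+ m)) =
   K%:R ^+ m.+1 * K%:R ^+ m.+1 * phi (K%:R ^+ m).
  by rewrite mulrA -!exprD; congr (_ ^+ _ * _); lia.
apply: ler_wpM2r; first exact: phi0.
apply: ler_wpM2l; first by rewrite exprn_ge0.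
by rewrite -natrX ler_nat leq_subr.
Qed.

Lemma condensation phi (K p N : nat) : (1 < K)%N ->
  (forall r : R, 0 < r -> 0 <= phi r) ->
  (forall r s : R, 0 < r -> r <= s -> phi s <= phi r) ->
  \sum_(K ^ p <= n < K ^ (p + N)) n%:R * phi n%:R <=
  K%:R ^+ 2 * \sum_(p <= m < p + N) (K%:R ^+ (2 * m) * phi (K%:R ^+ m)).
Proof.
move=> K1 phi0 phid; elim: N => [|N IH].
  by rewrite addn0 !big_geq// mulr0.
rewrite addnS big_nat_recr ?leq_addr//= mulrDr.
rewrite (@big_cat_nat _ _ _ (K ^ (p + N)))/=; last 2 first.
  by rewrite leq_exp2l// leq_addr.
  by rewrite leq_exp2l// leqW.
by apply: lerD => //; exact: condensation_block.
Qed.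

(** If these sums stayed bounded, their terms would tend to 0; the minimum would eventually be
    [phi (K ^ m)], and by [condensation] the series of [n * phi n] would converge. *)
Lemma truncated_condensation_diverges phi (K p : nat) (a B : R) : (1 < K)%N -> 0 < a ->
  (forall r : R, 0 < r -> 0 <= phi r) ->
  (forall r s : R, 0 < r -> r <= s -> phi s <= phi r) ->
  (\sum_(1 <= n <oo) (n%:R * phi n%:R)%:E = +oo)%E ->
  exists N, B <= \sum_(p <= m < p + N)
    (Num.min (phi (K%:R ^+ m)) (a / K%:R ^+ (2 * m)) / (a / K%:R ^+ (2 * m))).
Proof.
move=> K1 a0 phi0 phid div.
have K0 m : 0 < K%:R ^+ m :> R by rewrite exprn_gt0// ltr0n ltnW.
pose u m := Num.min (phi (K%:R ^+ m)) (a / K%:R ^+ (2 * m)) / (a / K%:R ^+ (2 * m)).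
have d0 m : 0 < a / K%:R ^+ (2 * m) by rewrite divr_gt0.
have u0 m : 0 <= u m.
  by rewrite divr_ge0 ?(ltW (d0 m))// le_min (ltW (d0 m)) phi0.
apply: contrapT => /forallNP bnd.
have ub N : \sum_(p <= m < p + N) u m <= B by rewrite ltW// ltNge; apply/negP/bnd.
pose v i := u (p + i)%N.
have vE n : series v n = \sum_(p <= m < p + n) u m.
  elim: n => [|n IH]; first by rewrite addn0 /series /= !big_geq.
  by rewrite seriesSr IH addnS big_nat_recr ?leq_addr.
have cv : cvgn (series v).
  apply: nondecreasing_is_cvgn; last by exists B => _ [n _ <-]; rewrite vE.
  by apply: nondecreasing_series => i _ _; exact: u0.
have := cvgr_lt _ (cvg_series_cvg_0 cv) 1 ltr01.
move=> [n0 _ hn0].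
have uE m : (p + n0 <= m)%N -> a * u m = K%:R ^+ (2 * m) * phi (K%:R ^+ m).
  move=> pm; have := hn0 (m - p)%N; rewrite /v subnKC; last by lia.
  rewrite /= => /(_ ltac:(lia)); rewrite /u minEle; case: ifPn => [_ _|_].
    by field; rewrite !gt_eqF//.
  by rewrite divff ?ltxx// gt_eqF.
pose C := \sum_(1 <= n < K ^ (p + n0)) n%:R * phi n%:R + K%:R ^+ 2 * (a * B).
suff : (\sum_(1 <= n <oo) (n%:R * phi n%:R)%:E <= C%:E)%E by rewrite div leye_eq.
have t0 n : (1 <= n)%N -> 0 <= n%:R * phi n%:R :> R.
  by move=> n1; rewrite mulr_ge0// phi0// ltr0n.
apply: lime_le.
  by apply: is_cvg_nneseries => n n1 _; rewrite lee_fin t0.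
apply: nearW => n; rewrite sumEFin lee_fin.
pose n' := (K ^ (p + n0 + n))%N.
have Kn m : (0 < K ^ m)%N by rewrite expn_gt0 ltnW.
have nn' : (n <= n')%N.
  by rewrite /n' (leq_trans (ltnW (ltn_expl n K1)))// leq_exp2l// leq_addl.
apply: (@le_trans _ _ (\sum_(1 <= i < n') i%:R * phi i%:R)).
  have [n1|n1] := leqP n 1.
    by rewrite [leLHS]big_geq//; rewrite big_nat; apply: sumr_ge0 => i /andP[i1 _]; exact: t0.
  rewrite (@big_cat_nat _ _ _ n 1 n')//=; last exact: ltnW.
  rewrite lerDl; rewrite big_nat; apply: sumr_ge0 => i /andP[i1 _]; apply: t0; lia.
rewrite (@big_cat_nat _ _ _ (K ^ (p + n0)) 1 n')//=; last first.
  by rewrite leq_exp2l// leq_addr.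
rewrite lerD2l (le_trans (condensation (p + n0) n K1 phi0 phid))//.
rewrite ler_pM2l//.
have -> : \sum_(p + n0 <= m < p + n0 + n) K%:R ^+ (2 * m) * phi (K%:R ^+ m) =
   a * \sum_(p + n0 <= m < p + n0 + n) u m.
  by rewrite mulr_sumr; apply: eq_big_nat => m /andP[m1 _]; rewrite uE.
rewrite ler_pM2l// (le_trans _ (ub (n0 + n)%N))//.
rewrite addnA (@big_cat_nat _ _ _ (p + n0) p)/= ?leq_addr// lerDr.
by apply: sumr_ge0 => i _.
Qed.

End Greedy.

(** * Filling intervals by disjoint balls *)

Section KGB.
Context {R : realType}.
Implicit Types (S : set R) (l phi : R -> R).

Lemma len_cc (a b : R) : a <= b -> len `[a, b] = b - a.
Proof. by move=> ab; rewrite /len lebesgue_measure_cc. Qed.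

(** [kappa] is uniform over all intervals, all lower bounds [L] on lengths and all caps [eta] on
    radii. As radii are summed, the filled proportion is at least [2 * kappa]. *)
Definition fills_intervals S l phi (kappa : R) : Prop :=
  forall al be L eta : R, al < be -> - (pi / 2) <= al -> be <= pi / 2 -> 0 < eta ->
  exists F : seq (R * R), [/\ pairwise separated F,
    forall u, u \in F -> [/\ S u.1, L < l u.1, 0 < u.2 <= eta, u.2 <= phi (l u.1) &
       al <= u.1 - u.2 /\ u.1 + u.2 <= be] &
    kappa * (be - al) <= \sum_(u <- F) u.2].

Let level_identity (a M h x y : R) : x != 0 -> y != 0 ->
  8 * (a / (x * y)) * (M * (6 * h) * y) = 48 * M * h * (a / x).
Proof. by move=> x0 y0; field; rewrite x0 y0. Qed.

(** Each level [m] adds at least [c * h / 6 * u m], where [u m] is the truncated term of the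
    condensed series; divergence forces the total to reach [c * h]. *)
Lemma ubiquitous_fills_intervals S l phi : planar_resonant_set S l ->
  ubiquitous S l -> isotropic_quadratic_growth S l ->
  (forall r : R, 0 < r -> 0 <= phi r) ->
  (forall r s : R, 0 < r -> r <= s -> phi s <= phi r) ->
  (\sum_(1 <= n <oo) (n%:R * phi n%:R)%:E = +oo)%E ->
  exists2 kappa : R, 0 < kappa & fills_intervals S l phi kappa.
Proof.
move=> resS ubi [M M0 iso] phi0 phid div.
(* At level [m], the quantity [8 * d * N] of [new_resonances], with [d = a / K ^ (2 * m)] and
   [N = M * (6 * h) * K ^ (2 * (m - 1))], is [48 * M * h * a / K ^ 2]; this threshold makes it at
   most [c * h]. *)
have e0 : 0 < (48 * M)^-1 by rewrite invr_gt0; lra.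
have [K [c [c2 [a [[K1 c0 c20 a0 acK] {}ubi]]]]] := ubiquity_constants ubi e0.
exists (c / 8); first by lra.
move=> al be L eta albe alpi bepi eta0.
pose h := (be - al) / 8; have h0 : 0 < h by rewrite /h; lra.
have -> : c / 8 * (be - al) = c * h by rewrite /h; field.
have {bepi} hpi : al + 8 * h <= pi / 2 by rewrite /h; lra.
have beE : be = al + 8 * h by rewrite /h; field.
have len4 : len `[al + 2 * h, al + 6 * h] = 4 * h by rewrite len_cc; lra.
have len6 : len `[al + h, al + 7 * h] = 6 * h by rewrite len_cc; lra.
have sub4 : direction_interval `[al + 2 * h, al + 6 * h].
  by apply: is_interval_itv_sub; lra.
have sub6 : direction_interval `[al + h, al + 7 * h].
  by apply: is_interval_itv_sub; lra.
have K0 m : 0 < K%:R ^+ m :> R by rewrite exprn_gt0// ltr0n ltnW.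
(* The five bounds serve, in order: lengths beyond [L], the condition for isotropic growth on length
   [6 * h], [d m <= h], [d m <= eta], and the condition for ubiquity on length [4 * h]. *)
have [p [[pL ph] [pah paeta pc2]]] : exists p, (L <= K%:R ^+ p /\ (6 * h)^-1 <= K%:R ^+ p) /\
    [/\ a / h <= K%:R ^+ p, a / eta <= K%:R ^+ p & c2 / (4 * h) <= K%:R ^+ p].
  pose X := `|L| + (6 * h)^-1 + a / h + a / eta + c2 / (4 * h).
  have [L0 LL] : 0 <= `|L| /\ L <= `|L| by rewrite normr_ge0 ler_norm.
  have h1 : 0 <= (6 * h)^-1 by rewrite invr_ge0; lra.
  have h2 : 0 <= a / h by rewrite divr_ge0// ltW.
  have h3 : 0 <= a / eta by rewrite divr_ge0// ltW.
  have h4 : 0 <= c2 / (4 * h) by rewrite divr_ge0// ?ltW// mulr_gt0.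
  exists (Num.truncn X).+1.
  have : X < K%:R ^+ (Num.truncn X).+1.
    rewrite (lt_trans (truncnS_gt X))// -natrX ltr_nat; exact: ltn_expl.
  by rewrite /X => ?; split; [|]; split; lra.
pose d m : R := a / K%:R ^+ (2 * m).
have d0 m : 0 < d m by rewrite divr_gt0.
have Kpm m : (p <= m)%N -> K%:R ^+ p <= K%:R ^+ m :> R.
  by move=> pm; rewrite -!natrX ler_nat leq_exp2l.
have dle m b : (p <= m)%N -> 0 < b -> a / b <= K%:R ^+ p -> d m <= b.
  move=> pm b0; rewrite ler_pdivrMr// /d ler_pdivrMr// => H.
  apply: le_trans H _; rewrite mulrC; apply: ler_wpM2l; first exact: ltW.
  by apply: Kpm; rewrite (leq_trans pm)// leq_pmull.
pose u m := Num.min (phi (K%:R ^+ m)) (d m) / d m.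
have u0 m : 0 <= u m by rewrite divr_ge0 ?(ltW (d0 m))// le_min (ltW (d0 m)) phi0.
suff greedy N : exists F : seq (R * R), [/\ pairwise separated F,
    forall v, v \in F -> [/\ S v.1, K%:R ^+ p < l v.1 <= K%:R ^+ (p + N),
       0 < v.2 <= Num.min eta h, v.2 <= phi (l v.1) &
       al + h <= v.1 <= al + 7 * h] &
    c * h <= \sum_(v <- F) v.2 \/
    (c * h / 6) * \sum_(p.+1 <= m < p.+1 + N) u m <= \sum_(v <- F) v.2].
  (* Once the sum of [u] reaches 6, the second alternative of [greedy] also yields [c * h]. *)
  have [N hN] := truncated_condensation_diverges p.+1 6 K1 a0 phi0 phid div.
  have [F [sF FP sumF]] := greedy N; exists F; split => //.
    move=> v /FP[Sv /andP[pv _] /andP[v0]]; rewrite le_min => /andP[ve vh] vphi /andP[v1 v2].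
    split => //; [exact: le_lt_trans pv|by rewrite v0|].
    by rewrite beE; split; lra.
  case: sumF => // sumF; rewrite (le_trans _ sumF)//.
  have ch : 0 <= c * h / 6 by rewrite divr_ge0// mulr_ge0 ?ltW.
  have := ler_wpM2l ch hN; rewrite -/d -/u; lra.
elim: N => [|N [F [sF FP sumF]]].
  exists [::]; split => //; right.
  by rewrite addn0 !big_geq// big_nil mulr0.
have KN : K%:R ^+ (p + N) <= K%:R ^+ (p + N.+1) :> R.
  by rewrite -!natrX ler_nat leq_exp2l// addnS.
have FP' v : v \in F -> [/\ S v.1, K%:R ^+ p < l v.1 <= K%:R ^+ (p + N.+1),
       0 < v.2 <= Num.min eta h, v.2 <= phi (l v.1) &
       al + h <= v.1 <= al + 7 * h].
  by move=> /FP[? /andP[-> ?] ? ? ?]; split => //=; exact: le_trans KN.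
have [done|small] := leP (c * h) (\sum_(v <- F) v.2).
  by exists F; split => //; left.
case: sumF => [|sumF]; first by rewrite leNgt small.
rewrite addSnnS in sumF; rewrite addSn big_nat_recr /=; last by rewrite -addSnnS leq_addr.
pose m := (p + N.+1)%N; rewrite -/m mulrDr.
have pm : (p <= m)%N by rewrite leq_addr.
pose r := Num.min (phi (K%:R ^+ m)) (d m).
have rE : r = d m * u m by rewrite /u -/r mulrCA divff ?mulr1// gt_eqF.
have [r0|r0] := leP r 0.
  exists F; split => //; right.
  suff -> : u m = 0 by rewrite mulr0 addr0.
  by apply/eqP; rewrite eq_le u0 andbT -(pmulr_rle0 _ (d0 m)) -rE.
have dmh : d m <= h by exact: dle.
have [G [pG GP sizeG]] : exists G : seq R, [/\ pairwise (fun x y => 2 * d m < `|x - y|) G,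
    forall x, x \in G -> [/\ S x, K%:R ^+ (p + N) < l x <= K%:R ^+ m, al + h <= x <= al + 7 * h &
      forall u, u \in F -> u.2 + 2 * d m < `|x - u.1|] &
    c * h <= 6 * d m * (size G)%:R].
  apply: (@new_resonances _ S l _ _ (M * (6 * h) * (K%:R ^+ (p + N)) ^+ 2) c al h (d m) F) => //.
  - move=> s us sP; apply: (size_le_counting us (A := [set t | (`[al + h, al + 7 * h] `&` S) t /\ l t <= K%:R ^+ (p + N)])).
      by move=> t /sP[? ? ?]; split=> //; split => //; rewrite /= in_itv.
    rewrite -len6; apply: iso => //.
    rewrite len6 -ler_pdivrMr ?div1r; last by rewrite mulr_gt0.
    apply: le_trans ph _; rewrite -exprM; apply: Kpm.
    by rewrite muln2 -addnn -addnA leq_addr.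
  - rewrite -len4; apply: ubi => //.
    rewrite len4 ler_pdivrMr// mulrC -ler_pdivrMr; last by rewrite mulr_gt0.
    by apply: le_trans pc2 _; exact: Kpm.
  - have -> : 8 * d m * (M * (6 * h) * (K%:R ^+ (p + N)) ^+ 2) = 48 * M * h * (a / K%:R ^+ 2).
      by rewrite /d /m addnS mulnS exprD -exprM [(_ * 2)%N]mulnC level_identity ?gt_eqF.
    move: acK; rewrite mulrAC ler_pdivrMr// => acK.
    have {acK} := ler_wpM2l (ltW h0) (ler_wpM2l (ltW M0) acK).
    have -> : h * (M * ((48 * M)^-1 * c)) = c * h / 48 by field; rewrite gt_eqF.
    lra.
  - move=> v /FP[Sv /andP[_ vN] /andP[v0 _] _ vh]; split => //; exact: ltW.
  - exact: ltW.
exists (F ++ [seq (x, r) | x <- G]); split.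
- rewrite pairwise_cat sF pairwise_map; apply/and3P; split => //.
    apply/allrelP => v w /= vF /mapP[x xG ->]; have [_ _ _ xF] := GP x xG.
    rewrite /separated /= distrC (le_lt_trans _ (xF v vF))// lerD2l.
    by rewrite ge_min; apply/orP; right; have := d0 m; lra.
  apply: sub_pairwise pG => x y /=; rewrite /separated/= => xy.
  rewrite (le_lt_trans _ xy)//.
  have : r <= d m by rewrite ge_min lexx orbT.
  lra.
- move=> v; rewrite mem_cat => /orP[/FP'//|/mapP[x xG ->]] /=.
  have [Sx /andP[x1 x2] xh _] := GP x xG.
  split => //.
  - by rewrite x2 andbT (le_lt_trans _ x1)// Kpm// leq_addr.
  - apply/andP; split; first exact: r0.
    by rewrite le_min !ge_min dmh (dle m eta pm eta0 paeta) !orbT.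
  - by rewrite ge_min phid//; rewrite (lt_trans _ x1).
(* The new balls have total radius [size G * d m * u m], and [6 * d m * size G] is at least
   [c * h]. *)
right; rewrite big_cat big_map /= sumr_const_seq; apply: lerD => //.
rewrite rE mulrA ler_wpM2r//; lra.
Qed.

End KGB.

(** * Several generations of balls *)

Section Multilevel.
Context {R : realType}.
Implicit Types (S : set R) (l f psi : R -> R).

(* A triple ((t, r), rho) stands for two concentric intervals of centre [t]:
   the large one, of radius [r], carries the weight of the resonance [t], the
   small one, of radius [rho], lies in the ball of radius [psi (l t)]. *)
Definition well_spaced (u v : R * R * R) : bool :=
  u.2 + v.2 + Num.min u.1.2 v.1.2 / 2 < `|u.1.1 - v.1.1|.

Definition superlinear_at0 f : Prop :=
  forall q : R, exists2 r0 : R, 0 < r0 & forall r, 0 < r -> r < r0 -> q * r <= f r.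

Lemma superlinear_gt0 f : (forall r s : R, 0 <= r -> r <= s -> f r <= f s) ->
  superlinear_at0 f -> forall r : R, 0 < r -> 0 < f r.
Proof.
move=> fi /(_ 1)[s s0 fs] r r0.
have m0 : 0 < Num.min r (s / 2) by rewrite lt_min r0 divr_gt0.
apply: lt_le_trans (fi _ _ (ltW m0) _); last by rewrite ge_min lexx.
apply: (lt_le_trans m0); rewrite -[leLHS]mul1r; apply: fs; first exact: m0.
by rewrite gt_min; apply/orP; right; lra.
Qed.

Lemma well_spaced_sym : symmetric well_spaced.
Proof.
by move=> u v; rewrite /well_spaced distrC [u.2 + _]addrC minC.
Qed.

Lemma sum_radii_near (F : seq (R * R)) (P : pred (R * R)) (x y : R) : 0 <= y ->
  pairwise separated F -> (forall u, u \in F -> 0 <= u.2) ->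
  (forall u, u \in F -> P u -> `|u.1 - x| + u.2 <= y) ->
  \sum_(u <- F | P u) u.2 <= y.
Proof.
move=> y0 sF F0 FP.
have : \sum_(u <- [seq u <- F | P u]) 2 * u.2 <= (x + y) - (x - y).
  apply: sum_radii_packing; first lra.
    exact: pairwise_filter.
  move=> u; rewrite mem_filter => /andP[Pu uF].
  have := FP u uF Pu; have := F0 u uF => u0 h.
  have : - (y - u.2) <= u.1 - x <= y - u.2 by rewrite -ler_norml; lra.
  by move=> /andP[h1 h2]; split => //; lra.
rewrite -mulr_sumr big_filter; lra.
Qed.

(** Induction on the number [q] of generations. A new generation has weight at least
    [kappa * (be - al)]; the balls too close to small intervals of earlier generations are dropped,
    and as these are tiny, at most half of that amount is lost. *)
Lemma multilevel_family S l f psi (kappa eps : R) : 0 < kappa ->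
  0 < eps -> eps <= 1 / 2 ->
  f 0 = 0 -> (forall r s : R, 0 <= r -> r <= s -> f r <= f s) ->
  superlinear_at0 f ->
  (forall t, S t -> 0 < l t) ->
  (forall r : R, 0 < r -> 0 <= psi r) ->
  fills_intervals S l (f \o psi) kappa ->
  forall (al be L : R) (q : nat), al < be -> - (pi / 2) <= al -> be <= pi / 2 ->
  q%:R * eps <= kappa / 4 ->
  exists F : seq (R * R * R), [/\ pairwise well_spaced F,
    forall u, u \in F -> [/\ S u.1.1, L < l u.1.1, 0 < u.2 < psi (l u.1.1),
       u.2 <= u.1.2 / 4 /\ u.1.2 <= f (2 * u.2) &
       al <= u.1.1 - u.1.2 /\ u.1.1 + u.1.2 <= be],
    forall x y, 0 < y ->
      \sum_(u <- F | (u.1.2 <= 2 * y) && (`|u.1.1 - x| <= 2 * y)) u.1.2 <= q%:R * (4 * y),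
    q%:R * (kappa / 2) * (be - al) <= \sum_(u <- F) u.1.2 &
    \sum_(u <- F) u.2 <= q%:R * eps * (be - al)].
Proof.
move=> kappa0 eps0 eps2 f0 fi fbig l0 psi0 kgb al be L q albe alpi bepi.
have J0 : 0 < be - al by lra.
elim: q => [_|q IH qeps].
  by exists [::]; split => // [x y y0||]; rewrite ?big_nil ?mul0r.
have {IH} [|F [sF FP Fnear Fbig Fsmall]] := IH.
  apply: le_trans qeps; rewrite ler_pM2r// ler_nat//.
have qE : q.+1%:R = q%:R + 1 :> R by rewrite -natr1.
have [r0 r00 fr0] := fbig eps^-1.
(* The first bound gives [u.2 <= f (eps * u.2)] by superlinearity; the second keeps the boundary
   losses, [2 * eta] for each earlier interval, at most [kappa / 4 * (be - al)] in total. *)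
pose eta := Num.min (r0 / (2 * eps)) (kappa * (be - al) / (8 * ((size F)%:R + 1))).
have n0 : 0 < (size F)%:R + 1 :> R by rewrite ltr_wpDl.
have eta0 : 0 < eta.
  by rewrite lt_min !divr_gt0// ?mulr_gt0.
have [G [sG GP Gbig]] := kgb al be L eta albe alpi bepi eta0.
(* Thus [2 * rho u] is either [psi (l u.1)] or [eps * u.2], and in both cases its image under [f] is
   at least [u.2]. *)
pose rho (u : R * R) := Num.min (psi (l u.1)) (eps * u.2) / 2.
have G0 u : u \in G -> 0 < u.2 by move=> /GP[_ _ /andP[]].
have rhoP u : u \in G -> [/\ 0 < rho u < psi (l u.1), rho u <= eps * u.2 / 2 & u.2 <= f (2 * rho u)].
  move=> uG; have [Su _ /andP[u0 ueta] uf _] := GP u uG.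
  have psiu : 0 < psi (l u.1).
    rewrite lt_def psi0 ?l0// andbT; apply/eqP => psi00.
    by move: uf; rewrite /= psi00 f0 leNgt u0.
  have eu : 0 < eps * u.2 by rewrite mulr_gt0.
  split.
  - have : Num.min (psi (l u.1)) (eps * u.2) <= psi (l u.1) by rewrite ge_min lexx.
    have : 0 < Num.min (psi (l u.1)) (eps * u.2) by rewrite lt_min psiu.
    by rewrite /rho => ? ?; apply/andP; split; lra.
  - by rewrite /rho ler_pM2r ?invr_gt0// ge_min lexx orbT.
  rewrite /rho mulrC divfK// minEle; case: ifPn => // _.
  have := fr0 (eps * u.2) eu; rewrite mulrA mulVf ?gt_eqF// mul1r; apply.
  have : u.2 <= r0 / (2 * eps) by rewrite (le_trans ueta)// ge_min lexx.
  rewrite ler_pdivlMr ?mulr_gt0//; lra.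
pose good (u : R * R) := all (fun v : R * R * R => well_spaced (u, rho u) v) F.
pose G' := [seq u <- G | good u].
exists (F ++ [seq (u, rho u) | u <- G']); split.
- rewrite pairwise_cat sF pairwise_map/=; apply/andP; split.
    apply/allrelP => v w vF /mapP[u]; rewrite mem_filter => /andP[/allP gu uG] ->.
    by rewrite well_spaced_sym; exact: gu.
  apply: (@sub_in_pairwise _ (mem G) separated); last 2 first.
    by apply/allP => u; rewrite mem_filter => /andP[].
    exact: pairwise_filter.
  move=> u v uG vG; rewrite /separated /well_spaced /=; apply: le_lt_trans.
  have [_ ru _] := rhoP u uG; have [_ rv _] := rhoP v vG.
  have := G0 u uG; have := G0 v vG => v0 u0.
  have : eps * u.2 <= 1 / 2 * u.2 by rewrite ler_pM2r.
  have : eps * v.2 <= 1 / 2 * v.2 by rewrite ler_pM2r.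
  have : Num.min u.2 v.2 <= u.2 by rewrite ge_min lexx.
  lra.
- move=> v; rewrite mem_cat => /orP[/FP//|/mapP[u]].
  rewrite mem_filter => /andP[_ uG] -> /=.
  have [rho0 rhoe fu] := rhoP u uG; have [Su Lu _ _ Ju] := GP u uG.
  split => //; split => //; have : eps * u.2 <= 1 / 2 * u.2 by rewrite ler_pM2r// G0.
  lra.
(* Each generation adds at most [4 * y], since its selected large intervals are disjoint and lie
   within [4 * y] of [x]. *)
- move=> x y y0; rewrite big_cat big_map/= qE [leRHS]mulrDl mul1r; apply: lerD; first exact: Fnear.
  apply: (sum_radii_near (x := x)); first lra.
  + exact: pairwise_filter.
  + by move=> u; rewrite mem_filter => /andP[_ /G0/ltW].
  + by move=> u _ /andP[h1 h2]; lra.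
- rewrite big_cat big_map/= qE 2!mulrDl mul1r; apply: lerD => //; rewrite big_filter.
  have : \sum_(u <- G) u.2 = \sum_(u <- G | good u) u.2 + \sum_(u <- G | ~~ good u) u.2.
    by rewrite (bigID good).
  suff : \sum_(u <- G | ~~ good u) u.2 <= kappa / 2 * (be - al) by lra.
  (* A ball not well spaced from [v] lies in the small interval of [v] enlarged by [2 * eta]: the
     excess is at most [u.2 * (1 + 1 / 2 + 1 / 4)]. *)
  pose bad (v : R * R * R) (u : R * R) := `|u.1 - v.1.1| + u.2 <= v.2 + 2 * eta.
  apply: (@le_trans _ _ (\sum_(v <- F) \sum_(u <- G | bad v u) u.2)).
    rewrite (exchange_big_dep xpredT)//= [leLHS]big_mkcond /=.
    rewrite [leLHS]big_seq [leRHS]big_seq; apply: ler_sum => u uG.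
    have u0 := G0 u uG.
    have sum0 : 0 <= \sum_(v <- F | bad v u) u.2 by apply: sumr_ge0 => v _; exact: ltW.
    case: ifPn => // /allPn[v vF] wuv.
    rewrite (big_rem v)//=; have -> : bad v u.
      move: wuv; rewrite /well_spaced -leNgt /= => wuv; rewrite /bad.
      have [_ ru _] := rhoP u uG.
      have : eps * u.2 <= 1 / 2 * u.2 by rewrite ler_pM2r.
      have : Num.min u.2 v.1.2 <= u.2 by rewrite ge_min lexx.
      have [_ _ /andP[_ ue] _ _] := GP u uG; lra.
    by rewrite lerDl; apply: sumr_ge0 => *; exact: ltW.
  apply: (@le_trans _ _ (\sum_(v <- F) (v.2 + 2 * eta))).
    rewrite [leLHS]big_seq [leRHS]big_seq; apply: ler_sum => v vF.
    have [_ _ /andP[v0 _] _ _] := FP v vF.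
    by apply: (sum_radii_near (x := v.1.1)) => //; [lra|move=> u /G0/ltW].
  rewrite big_split /= sumr_const_seq.
  have : q%:R * eps * (be - al) <= kappa / 4 * (be - al).
    rewrite ler_pM2r//; apply: le_trans qeps; rewrite ler_pM2r// ler_nat//.
  have : (size F)%:R * eta <= kappa * (be - al) / 8.
    apply: (@le_trans _ _ (((size F)%:R + 1) * (kappa * (be - al) / (8 * ((size F)%:R + 1))))).
      apply: ler_pM => //; [exact: ltW|by rewrite lerDl|by rewrite ge_min lexx orbT].
    rewrite le_eqVlt; apply/orP; left; apply/eqP; field; rewrite gt_eqF//.
  lra.
rewrite big_cat big_map/= qE 2!mulrDl mul1r; apply: lerD => //.
have := @sum_radii_packing _ G' al be (ltW albe) (pairwise_filter _ sG).
rewrite -mulr_sumr => pack.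
have {pack} : 2 * \sum_(u <- G') u.2 <= be - al.
  by apply: pack => u; rewrite mem_filter => /andP[_ /GP[_ _ /andP[/ltW ? _] _ [? ?]]].
move=> pack.
apply: (@le_trans _ _ (\sum_(u <- G') eps / 2 * u.2)).
  rewrite [leLHS]big_seq [leRHS]big_seq; apply: ler_sum => u.
  rewrite mem_filter => /andP[_ /rhoP[_ h _]]; lra.
rewrite -mulr_sumr; have := ler_wpM2l (ltW eps0) pack.
have := mulr_gt0 eps0 J0; lra.
Qed.

End Multilevel.

(** * Points of the limsup set outside a cover *)

Section Escape.
Context {R : realType}.
Implicit Types (S : set R) (l f psi : R -> R) (A : nat -> set R) (w lam : nat -> R).

Definition meets (E : set R) (a b : R) : bool := `[< (E `&` `[a, b]) !=set0 >].

Definition load A w (a b : R) : \bar R :=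
  (\sum_(i <oo) (if meets (A i) a b then w i else 0)%:E)%E.

Lemma pairwise_uniq_in (T : eqType) (r : rel T) (s : seq T) :
  (forall u, u \in s -> ~~ r u u) -> pairwise r s -> uniq s.
Proof.
elim: s => //= u s IH rs /andP[/allP us ps]; apply/andP; split.
  by apply/negP => /us; exact/negP/rs/mem_head.
by apply: IH => // v vs; apply: rs; rewrite inE vs orbT.
Qed.

Lemma load_term_ge0 A w a b i : 0 <= w i ->
  (0 <= (if meets (A i) a b then w i else 0)%:E)%E.
Proof. by case: ifP; rewrite lee_fin. Qed.

Lemma le_load A w (a b : R) i (c : R) : (forall j, 0 <= w j) ->
  meets (A i) a b -> (load A w a b <= c%:E)%E -> w i <= c.
Proof.
move=> w0 ab; rewrite -lee_fin; apply: le_trans.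
apply: le_trans (nneseries_lim_ge i.+1 _); last by move=> j _ _; exact: load_term_ge0.
rewrite big_nat_recr//= ab leeDr//; apply: sume_ge0 => j _; exact: load_term_ge0.
Qed.

(* A set of the cover kills the intervals of the family whose weight radius is
   comparable to its diameter, and is inherited by at most one other interval. *)
Lemma lightly_loaded_child S l f psi A lam (kappa : R) : 0 < kappa -> kappa <= 1 ->
  f 0 = 0 -> (forall r s : R, 0 <= r -> r <= s -> f r <= f s) ->
  superlinear_at0 f ->
  (forall t, S t -> 0 < l t) ->
  (forall r : R, 0 < r -> 0 <= psi r) ->
  fills_intervals S l (f \o psi) kappa ->
  (forall i, 0 < lam i) ->
  (forall i x y, A i x -> A i y -> `|x - y| <= lam i) ->
  forall al be L Phi : R, al < be -> - (pi / 2) <= al -> be <= pi / 2 ->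
  (load A lam al be <= (kappa / 16 * (be - al))%:E)%E ->
  (load A (f \o lam) al be <= Phi%:E)%E ->
  exists t rho : R, [/\ S t, L < l t, 0 < rho < psi (l t),
    al <= t - rho /\ t + rho <= be & 2 * rho <= (be - al) / 2 /\
    (load A (f \o lam) (t - rho) (t + rho) <= (kappa / 16 * f (2 * rho))%:E)%E].
Proof.
move=> kappa0 kappa1 f0 fi fbig l0 psi0 kgb lam0 diam al be L Phi albe alpi bepi loadlam loadf.
have J0 : 0 < be - al by lra.
have c0 : 0 < kappa / 16 by lra.
pose c := kappa / 16; rewrite -/c in loadlam c0 *.
have f_ge0 r : 0 <= r -> 0 <= f r by move=> r0; rewrite -f0 fi.
have fl0 i : 0 <= (f \o lam) i by apply/f_ge0/ltW.
(* The family below weighs at least twice [q * (kappa / 4 * (be - al))]. One half bounds the charges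
   for killed intervals, at most [4 * q] times the [lam]-load; the other must exceed the charges
   [Phi / c] for inherited sets. *)
pose q := (Num.truncn (`|Phi| / c / (kappa / 4 * (be - al)))).+1.
have qP : `|Phi| / c < q%:R * (kappa / 4 * (be - al)).
  rewrite -ltr_pdivrMr; first exact: truncnS_gt.
  by rewrite mulr_gt0// divr_gt0.
have q0 : 0 < q%:R :> R by rewrite ltr0n.
pose eps : R := Num.min (1 / 2) (kappa / 4 / q%:R).
have eps0 : 0 < eps by rewrite lt_min !divr_gt0.
have eps2 : eps <= 1 / 2 by rewrite ge_min lexx.
have qeps : q%:R * eps <= kappa / 4 by rewrite mulrC -ler_pdivlMr// ge_min lexx orbT.
have [F [sF FP Fnear Fbig _]] :=
  multilevel_family kappa0 eps0 eps2 f0 fi fbig l0 psi0 kgb L albe alpi bepi qeps.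
apply: contrapT => nochild.
pose tch i (u : R * R * R) := meets (A i) (u.1.1 - u.2) (u.1.1 + u.2).
pose kill i (u : R * R * R) := tch i u && (u.1.2 <= 2 * lam i).
pose pass i (u : R * R * R) := tch i u && ~~ (u.1.2 <= 2 * lam i).
have uP u : u \in F -> 0 < u.1.2 /\ 0 < u.2.
  by move=> /FP[_ _ /andP[h _] [h1 _] _]; split=> //; lra.
have tchP i u : tch i u -> exists2 y, A i y & `|u.1.1 - y| <= u.2.
  move=> /asboolP[y [Ay]]; rewrite /= in_itv /= => /andP[h1 h2]; exists y => //.
  by rewrite ler_norml; apply/andP; split; lra.
have tchJ i u : u \in F -> tch i u -> meets (A i) al be.
  move=> uF /asboolP[y [Ay]]; rewrite /= in_itv /= => /andP[h1 h2].
  have [_ _ _ [h3 _] [h4 h5]] := FP u uF; have [h6 h7] := uP u uF.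
  apply/asboolP; exists y; split => //; rewrite /= in_itv /=; apply/andP; split; lra.
(* The charge of [A i] to [u]: the whole weight if it kills [u], its [f]-size over [c] if [u]
   inherits it. *)
pose T i u := (if kill i u then u.1.2 else 0) + c^-1 * (if pass i u then f (lam i) else 0).
have T0 i u : u \in F -> 0 <= T i u.
  move=> uF; have [u0 _] := uP u uF; rewrite addr_ge0//; first by case: ifP => // _; exact: ltW.
  by rewrite mulr_ge0 ?invr_ge0 ?(ltW c0)//; case: ifP => // _; exact: fl0.
(* An interval that nothing kills inherits a load of at least [c * f (2 * u.2)], hence at least
   [c * u.1.2], because it is not the child sought. *)
have lower u : u \in F -> (u.1.2%:E <= \sum_(i <oo) (T i u)%:E)%E.
  move=> uF; have [u0 rho0] := uP u uF.
  have [[i iu]|nokill] := pselect (exists i, kill i u).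
    apply: le_trans (nneseries_lim_ge i.+1 _); last first.
      by move=> j _ _; rewrite lee_fin T0.
    rewrite big_nat_recr//= {2}/T iu.
    apply: le_trans (leeDr _ _); last by apply: sume_ge0 => j _; rewrite lee_fin T0.
    by rewrite lee_fin lerDl mulr_ge0 ?invr_ge0 ?(ltW c0)//; case: ifP => // _; exact: fl0.
  have [Su Lu urho [ur uf] [u1 u2]] := FP u uF.
  have -> : (\sum_(i <oo) (T i u)%:E = c^-1%:E * load A (f \o lam) (u.1.1 - u.2) (u.1.1 + u.2))%E.
    rewrite /load -nneseriesZl; last by move=> i _; exact: load_term_ge0.
    apply: eq_eseriesr => i _; rewrite /T -EFinM.
    have nk : ~~ kill i u by apply/negP => ki; apply: nokill; exists i.
    rewrite (negbTE nk) add0r; congr (c^-1 * _)%:E.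
    by rewrite /pass /tch; move: nk; rewrite /kill /tch; case: meets => //= ->.
  rewrite lee_pdivlMl//; apply: contrapT => /negP; rewrite -ltNge => small.
  apply: nochild; exists u.1.1, u.2; split => //; first by split; lra.
  split; first lra.
  apply: ltW; apply: lt_le_trans small _; rewrite -EFinM lee_fin.
  by rewrite ler_pM2l.
have upper i : \sum_(u <- F) T i u <=
    if meets (A i) al be then q%:R * (4 * lam i) + c^-1 * f (lam i) else 0.
  case: ifPn => [mJ|nJ]; last first.
    rewrite big_seq big1// => u uF; have nt : tch i u = false.
      by apply/negP => /(tchJ i u uF); exact/negP.
    by rewrite /T /kill /pass nt /= mulr0 addr0.
  have /asboolP[x [Ax _]] := mJ.
  rewrite big_split /= -mulr_sumr; apply: lerD.
    (* A killed interval meets [A i] and has small radius at most [lam i / 2], so its centre is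
       within [2 * lam i] of [x]. *)
    apply: le_trans (Fnear x (lam i) (lam0 i)).
    rewrite [leRHS]big_mkcond /= [leLHS]big_seq [leRHS]big_seq; apply: ler_sum => u uF.
    have [u0 rho0] := uP u uF.
    rewrite /kill; case: (boolP (tch i u)) => [tu|_] /=; last by case: ifP => // _; exact: ltW.
    case: ifPn => //= small.
    have [y Ay uy] := tchP i u tu.
    suff -> : `|u.1.1 - x| <= 2 * lam i by [].
    have [_ _ _ [h _] _] := FP u uF.
    rewrite (le_trans (ler_distD y _ _))//; have := diam i y x Ay Ax; lra.
  rewrite ler_pM2l ?invr_gt0//.
  have [[v vF pv]|nopass] := pselect (exists2 v, v \in F & pass i v); last first.
    rewrite big_seq big1 ?fl0// => u uF; case: ifPn => // pu; case: nopass; exists u => //.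
  have uniqF : uniq F.
    apply: pairwise_uniq_in sF => u uF; have [u0 rho0] := uP u uF.
    rewrite /well_spaced subrr normr0 -leNgt minxx; lra.
  rewrite (bigD1_seq v)//= pv big_seq_cond big1 ?addr0// => u /andP[uF uv].
  (* Two heirs would have centres at distance at most [u.2 + lam i + v.2], which contradicts the
     spacing because [2 * lam i] is less than both weight radii. *)
  case: ifPn => // pu; exfalso.
  have := pairwise_sym_mem well_spaced_sym sF uF vF uv.
  rewrite /well_spaced.
  move: pu pv => /andP[/tchP[y Ay uy]]; rewrite -ltNge => ul /andP[/tchP[z Az vz]].
  rewrite -ltNge => vl.
  have : lam i < Num.min u.1.2 v.1.2 / 2.
    have : 2 * lam i < Num.min u.1.2 v.1.2 by rewrite lt_min ul.
    lra.
  have := diam i y z Ay Az.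
  have := ler_distD y u.1.1 v.1.1; have := ler_distD z y v.1.1; rewrite [`|z - _|]distrC; lra.
have : ((\sum_(u <- F) u.1.2)%:E <= (q%:R * 4)%:E * load A lam al be + c^-1%:E * load A (f \o lam) al be)%E.
  rewrite /load -!nneseriesZl; last 2 first.
    by move=> i _; exact: load_term_ge0.
    by move=> i _; apply: load_term_ge0; exact: ltW.
  rewrite -nneseriesD; last 2 first.
  - move=> i _ _; apply: mule_ge0; first by rewrite lee_fin mulr_ge0.
    by apply: load_term_ge0; exact: ltW.
  - by move=> i _ _; rewrite mule_ge0 ?load_term_ge0// lee_fin invr_ge0 ltW.
  apply: (@le_trans _ _ (\sum_(u <- F) \sum_(i <oo) (T i u)%:E)%E).
    rewrite -sumEFin big_seq [leRHS]big_seq; apply: lee_sum => u uF; exact: lower.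
  rewrite big_seq -nneseries_sum; last by move=> u i uF; rewrite lee_fin T0.
  apply: lee_nneseries => [i _ _|i _].
    by apply: sume_ge0 => u uF; rewrite lee_fin T0.
  rewrite -big_seq sumEFin -!EFinM -EFinD lee_fin (le_trans (upper i))//.
  by case: ifP => _ /=; rewrite ?mulr0 ?addr0// mulrA.
have h1 : ((q%:R * 4)%:E * load A lam al be <= (q%:R * 4)%:E * (c * (be - al))%:E)%E.
  by apply: lee_wpmul2l => //; rewrite lee_fin.
have h2 : (c^-1%:E * load A (f \o lam) al be <= c^-1%:E * Phi%:E)%E.
  by apply: lee_wpmul2l => //; rewrite lee_fin invr_ge0 ltW.
move=> /le_trans /(_ (leeD h1 h2)); rewrite -!EFinM -EFinD lee_fin => h3.
have := le_trans Fbig h3.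
have -> : q%:R * 4 * (c * (be - al)) = q%:R * (kappa / 4 * (be - al)) by rewrite /c; field.
have : c^-1 * Phi <= `|Phi| / c by rewrite mulrC ler_pM2r ?invr_gt0// ler_norm.
have -> : q%:R * (kappa / 2) * (be - al) = 2 * (q%:R * (kappa / 4 * (be - al))) by field.
lra.
Qed.

End Escape.

(** * Iteration of the escape to a limit point *)

Section EscapeCover.
Context {R : realType}.
Implicit Types (S : set R) (l f psi : R -> R) (A : nat -> set R) (w lam : nat -> R).

(** A set that meets [[a, b]] has [f (lam i) < f (b - a)], hence [lam i <= b - a], and then
    [lam i / (b - a) <= f (lam i) / f (b - a)] since [f r / r] decreases. This restores the load
    hypothesis on [lam] for the next generation. *)
Lemma load_diameters f A lam (c a b : R) : a < b -> 0 <= c < 1 ->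
  (forall r s : R, 0 <= r -> r <= s -> f r <= f s) ->
  (forall r s : R, 0 < r -> r <= s -> f s / s <= f r / r) ->
  (forall i, 0 < lam i) -> (forall i, 0 <= f (lam i)) -> 0 < f (b - a) ->
  (load A (f \o lam) a b <= (c * f (b - a))%:E)%E ->
  (load A lam a b <= (c * (b - a))%:E)%E.
Proof.
move=> ab /andP[c0 c1] fi fd lam0 fl0 fj loadf.
have j0 : 0 < b - a by lra.
have -> : ((c * (b - a))%:E = ((b - a) / f (b - a))%:E * (c * f (b - a))%:E)%E.
  by rewrite -EFinM; congr _%:E; field; rewrite gt_eqF.
apply: (@le_trans _ _ (((b - a) / f (b - a))%:E * load A (f \o lam) a b)%E); last first.
  by apply: lee_wpmul2l => //; rewrite lee_fin divr_ge0// ltW.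
rewrite /load -nneseriesZl; last by move=> i _; apply: load_term_ge0; exact: fl0.
apply: lee_nneseries => [i _ _|i _]; first by apply: load_term_ge0; exact: ltW.
rewrite -EFinM lee_fin; case: ifPn => [mi|_]; last by rewrite mulr0.
have fli : f (lam i) <= c * f (b - a) by exact: (@le_load _ A (f \o lam) a b i).
have lj : lam i <= b - a.
  rewrite leNgt; apply/negP => /ltW /(fi _ _ (ltW j0)) h.
  have : c * f (b - a) < 1 * f (b - a) by rewrite ltr_pM2r.
  lra.
have := fd _ _ (lam0 i) lj; rewrite ler_pdivrMr// mulrAC ler_pdivlMr//= => h.
by rewrite mulrAC ler_pdivlMr// mulrC [leRHS]mulrC.
Qed.

Lemma nested_intervals (a b : nat -> R) : (forall n, a n <= b n) ->
  (forall n, a n <= a n.+1) -> (forall n, b n.+1 <= b n) ->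
  exists x, forall n, a n <= x <= b n.
Proof.
move=> ab ia db.
have aM m n : (m <= n)%N -> a m <= a n by have /nondecreasing_seqP h := ia; exact: h.
have bM m n : (m <= n)%N -> b n <= b m by have /nonincreasing_seqP h := db; exact: h.
have amb m n : a m <= b n.
  apply: le_trans (aM m (maxn m n) (leq_maxl _ _)) _.
  by apply: le_trans (ab _) (bM n (maxn m n) (leq_maxr _ _)).
exists (sup (range a)) => n; apply/andP; split.
  apply: ub_le_sup; last by exists n.
  by exists (b 0%N) => _ [m _ <-].
by apply: ge_sup; [exists (a 0%N), 0%N|move=> _ [m _ <-]].
Qed.

(** Iterating [lightly_loaded_child] gives nested intervals shrinking to a point. A set of the cover
    containing it would meet all of them, so [lam i] would be at most each of their loads, which
    tend to 0. *)
Lemma escape_cover S l f psi A lam (kappa Phi al be : R) : 0 < kappa -> kappa <= 1 ->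
  f 0 = 0 -> (forall r s : R, 0 <= r -> r <= s -> f r <= f s) ->
  superlinear_at0 f ->
  (forall r s : R, 0 < r -> r <= s -> f s / s <= f r / r) ->
  (forall t, S t -> 0 < l t) ->
  (forall r : R, 0 < r -> 0 <= psi r) ->
  fills_intervals S l (f \o psi) kappa ->
  (forall i, 0 < lam i) ->
  (forall i x y, A i x -> A i y -> `|x - y| <= lam i) ->
  al < be -> - (pi / 2) <= al -> be < pi / 2 ->
  (load A lam al be <= (kappa / 16 * (be - al))%:E)%E ->
  (load A (f \o lam) al be <= Phi%:E)%E ->
  exists2 x, limsup_set S l psi x & forall i, ~ A i x.
Proof.
move=> kappa0 kappa1 f0 fi fbig fd l0 psi0 kgb lam0 diam albe alpi bepi loadlam loadf.
have f_ge0 r : 0 <= r -> 0 <= f r by move=> r0; rewrite -f0 fi.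
have f_gt0 := superlinear_gt0 fi fbig.
(* Of the [f]-load only finiteness is carried along: its bound may change at each generation. *)
pose good (s : R * R) := [/\ s.1 < s.2, - (pi / 2) <= s.1, s.2 <= pi / 2,
   (load A lam s.1 s.2 <= (kappa / 16 * (s.2 - s.1))%:E)%E &
   exists Phi : R, (load A (f \o lam) s.1 s.2 <= Phi%:E)%E].
(* Letting the bound on [l t] grow with the step puts the limit point in balls of arbitrarily large
   length. *)
pose next (n : nat) (s s' : R * R) := [/\ s.1 <= s'.1, s'.2 <= s.2,
   s'.2 - s'.1 <= (s.2 - s.1) / 2 &
   exists2 t, S t /\ n%:R < l t & forall x, s'.1 <= x <= s'.2 -> `|x - t| < psi (l t)].
have step (ns : nat * {s | good s}) : exists s' : {s | good s}, next ns.1 (sval ns.2) (sval s').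
  case: ns => n [[a b] [/= ab api bpi ll [P lf]]].
  have [t [rho [St Lt /andP[rho0 rhopsi] [ta tb] [rhos lc]]]] :=
    lightly_loaded_child kappa0 kappa1 f0 fi fbig l0 psi0 kgb lam0 diam n%:R ab api bpi ll lf.
  have rE : t + rho - (t - rho) = 2 * rho by lra.
  have gs : good (t - rho, t + rho).
    split => /=; [lra|lra|lra| |by exists (kappa / 16 * f (2 * rho))].
    apply: (@load_diameters f) => //; [lra| |by move=> i; apply/f_ge0/ltW| |by rewrite rE].
      by apply/andP; split; lra.
    by rewrite rE; apply: f_gt0; lra.
  exists (exist _ _ gs); split => //=; first by rewrite rE.
  exists t => // x /andP[x1 x2]; rewrite ltr_norml; apply/andP; split; lra.
have [g gP] := choice step.
have gs0 : good (al, be) by split => //=; [exact: ltW|exists Phi].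
pose st := fix st n := if n is m.+1 then g (m, st m) else exist _ _ gs0.
have stP n : next n (sval (st n)) (sval (st n.+1)) by exact: (gP (n, st n)).
have [x xP] : exists x, forall n, (sval (st n)).1 <= x <= (sval (st n)).2.
  apply: (@nested_intervals (fun n => (sval (st n)).1) (fun n => (sval (st n)).2)).
  - by move=> n; case: (svalP (st n)) => /ltW.
  - by move=> n; case: (stP n).
  - by move=> n; case: (stP n).
(* The strict bound [be < pi / 2] keeps the limit point off the excluded endpoint. *)
have dirx : directions x.
  have /andP[x1 x2] := xP 0%N; rewrite /directions /= in_itv /=.
  by apply/andP; split; [exact: le_trans x1|exact: le_lt_trans bepi].
have lens n : (sval (st n)).2 - (sval (st n)).1 <= (be - al) / 2 ^+ n.
  elim: n => [|n IH]; first by rewrite expr0 divr1.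
  have [_ _ h _] := stP n; apply: le_trans h _; rewrite exprSr invfM mulrA.
  by rewrite ler_pM2r ?invr_gt0.
exists x.
  move=> L L0; have [_ _ _ [t [St nt] tx]] := stP (Num.truncn L).+1.
  exists t; first by split => //; apply: lt_trans nt; exact: truncnS_gt.
  split => //; exists 0; rewrite mul0r subr0; apply: tx; exact: xP.
move=> i Aix.
have lamle n : lam i <= (be - al) / 2 ^+ n.
  have [h1 _ _ h2 _] := svalP (st n).
  have mi : meets (A i) (sval (st n)).1 (sval (st n)).2.
    by apply/asboolP; exists x; split => //; rewrite /= in_itv; exact: xP.
  have lam00 j : 0 <= lam j by exact: ltW.
  have := le_load lam00 mi h2; have := lens n.
  set y := _ - _; have y0 : 0 < y by rewrite /y; lra.
  have : kappa / 16 * y <= 1 * y by rewrite ler_pM2r//; lra.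
  lra.
pose m := (Num.truncn ((be - al) / lam i)).+1.
have h1 : (be - al) / lam i < 2 ^+ m.
  by apply: lt_trans (truncnS_gt _) _; rewrite -natrX ltr_nat; exact: ltn_expl.
have := lamle m; rewrite ler_pdivlMr ?exprn_gt0// leNgt; apply/negP; rewrite negbK.
by move: h1; rewrite ltr_pdivrMr// mulrC.
Qed.

End EscapeCover.

(** * Hausdorff measures *)

Section Hausdorff.
Context {R : realType}.
Implicit Types (f : R -> R) (E : set R).

Lemma hausdorff_content_anti f E (rho rho' : R) : rho <= rho' ->
  (hausdorff_content f rho' E <= hausdorff_content f rho E)%E.
Proof.
move=> rr; apply: le_ereal_inf => _ [D [B [[HB cov] ->]]].
by exists D, B; split => //; split => // i Di; have [? h] := HB i Di; split => //; exact: le_trans rr.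
Qed.

Lemma hausdorff_measureE f E : hausdorff_measure f E =
  ereal_sup [set hausdorff_content f rho E | rho in [set` `]0, 1[]].
Proof.
apply/cvg_lim => //; apply: nonincreasing_at_right_cvge; first by rewrite bnd_simp.
by move=> x y _ _ xy; exact: hausdorff_content_anti.
Qed.

Lemma le_hausdorff_measure f E (rho : R) (c : \bar R) : 0 < rho ->
  (c <= hausdorff_content f rho E)%E -> (c <= hausdorff_measure f E)%E.
Proof.
move=> rho0 /le_trans; apply; rewrite hausdorff_measureE.
have m0 : 0 < Num.min rho (1 / 2) by rewrite lt_min rho0 divr_gt0.
apply: le_trans (ereal_sup_ubound _); last first.
  exists (Num.min rho (1 / 2)) => //=; rewrite in_itv /= m0 gt_min.
  by apply/orP; right; lra.
by apply: hausdorff_content_anti; rewrite ge_min lexx.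
Qed.

Lemma hausdorff_measure_le f E (c : \bar R) :
  (forall rho : R, 0 < rho -> (hausdorff_content f rho E <= c)%E) ->
  (hausdorff_measure f E <= c)%E.
Proof.
move=> H; rewrite hausdorff_measureE; apply: ub_ereal_sup => x [rho /=].
by rewrite in_itv /= => /andP[rho0 _] <-; exact: H.
Qed.

Lemma hausdorff_measure_mono f E E' : E `<=` E' ->
  (hausdorff_measure f E <= hausdorff_measure f E')%E.
Proof.
move=> EE; apply: hausdorff_measure_le => rho rho0.
apply: le_hausdorff_measure rho0 _; apply: le_ereal_inf => _ [D [B [[HB cov] ->]]].
by exists D, B; split => //; split => //; exact: subset_trans EE cov.
Qed.

Lemma len_ge0 E : 0 <= len E.
Proof. exact: fine_ge0. Qed.

Lemma lebesgue_measure_directions :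
  lebesgue_measure (directions : set R) = pi%:E.
Proof.
have -> := @lebesgue_measure_itv R `[- (pi / 2), pi / 2[ => /=.
have p0 := pi_gt0 R; rewrite lte_fin ifT; last lra.
by congr _%:E; lra.
Qed.

Lemma measurable_directions : measurable (directions : set R).
Proof. exact: measurable_itv. Qed.

Lemma lenE E : measurable E -> E `<=` directions ->
  lebesgue_measure E = (len E)%:E.
Proof.
move=> mE Ed; rewrite /len fineK// ge0_fin_numE//.
apply: (@le_lt_trans _ _ (lebesgue_measure (directions : set R))).
  by apply: le_measure => //; rewrite inE//; exact: measurable_directions.
by rewrite lebesgue_measure_directions ltry.
Qed.

Lemma le_len E E' : measurable E -> measurable E' -> E `<=` E' ->
  E' `<=` directions -> len E <= len E'.
Proof.
move=> mE mE' EE Ed; rewrite -lee_fin -!lenE//; last exact: subset_trans Ed.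
by apply: le_measure => //; rewrite inE.
Qed.

Lemma direction_interval_measurable E : direction_interval E -> measurable E.
Proof. by move=> [iE _]; exact: measurable_realfun.is_interval_measurable. Qed.

Lemma direction_interval_diam E x y : direction_interval E -> E x -> E y ->
  `|x - y| <= len E.
Proof.
move=> dE; wlog xy : x y / x <= y => [H|] Ex Ey.
  by have [/H|/ltW/H] := leP x y; [apply|rewrite distrC; apply].
rewrite distrC ger0_norm ?subr_ge0// -len_cc//.
have [iE Ed] := dE.
apply: le_len Ed => //; first exact: direction_interval_measurable.
by move=> z; rewrite /= in_itv /= => h; exact: iE Ex Ey _ h.
Qed.

Lemma esum_nneseries (D : set nat) (a : nat -> \bar R) :
  (forall i, D i -> (0 <= a i)%E) ->
  (\esum_(i in D) a i = \sum_(i <oo) (if `[< D i >] then a i else 0))%E.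
Proof.
move=> a0; rewrite esum_mkcond nneseries_esumT.
  by apply: eq_esum => i _; case: asboolP => Di; [rewrite mem_set|rewrite memNset].
by move=> i; case: asboolP => // /a0.
Qed.

(** Serves to replace the lengths of a cover, some of which may be 0, by slightly larger positive
    numbers at small cost in [f]. *)
Lemma right_continuous f (x d e : R) : {within `[0, +oo[, continuous f} ->
  0 <= x -> 0 < d -> 0 < e -> exists y, x < y < x + d /\ f y < f x + e.
Proof.
move=> /continuous_within_itvcyP[cf cf0] x0 d0 e0.
have cfx : f y @[y --> x^'+] --> f x.
  move: x0; rewrite le_eqVlt => /predU1P[<-//|x0].
  by apply: cvg_at_right_filter; apply: cf; rewrite in_itv /= x0.
have h1 : \forall y \near x^'+, f y < f x + e by apply: (cvgr_lt (f x) cfx); rewrite ltrDl.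
have h2 : \forall y \near x^'+, y < x + d by apply: nbhs_right_lt; rewrite ltrDl.
have h3 : \forall y \near x^'+, x < y by exact: nbhs_right_gt.
have [y [fy yd xy]] : exists y, [/\ f y < f x + e, y < x + d & x < y].
  by near (at_right x) => y; exists y; split; near: y.
by exists y; rewrite xy.
Unshelve. all: by end_near. Qed.

(** A cover of [f]-sum below [C] by short enough intervals loads [[- (pi / 4), pi / 4]] so lightly
    that [escape_cover] gives a point of the limsup set outside it. *)
Lemma hausdorff_measure_pinfty (S : set R) (l f psi : R -> R) (kappa : R) :
  0 < kappa -> kappa <= 1 ->
  f 0 = 0 -> dimension_function f ->
  superlinear_at0 f ->
  (forall r s : R, 0 < r -> r <= s -> f s / s <= f r / r) ->
  (forall t, S t -> 0 < l t) ->
  (forall r : R, 0 < r -> 0 <= psi r) ->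
  fills_intervals S l (f \o psi) kappa ->
  hausdorff_measure f (limsup_set S l psi) = +oo%E.
Proof.
move=> kappa0 kappa1 f0 dimf fbig fd l0 psi0 kgb.
have [f_ge0 fcont fi _] := dimf.
have pi0 := pi_gt0 R.
suff big (C : R) : 0 < C -> (C%:E <= hausdorff_measure f (limsup_set S l psi))%E.
  apply/eqyP => C C0; exact: big.
move=> C0; pose J : R := pi / 4 - - (pi / 4).
have J0 : 0 < J by rewrite /J; lra.
have m0 : 0 < kappa / 16 * J by rewrite mulr_gt0// divr_gt0.
(* Since [q * lam i <= f (lam i)], an [f]-load of at most [C + 1] gives a [lam]-load of at most
   [kappa / 16 * J], as [escape_cover] requires. *)
pose q := (C + 1) / (kappa / 16 * J).
have q0 : 0 < q by rewrite divr_gt0// addr_gt0.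
have [r0 r00 fr0] := fbig q.
apply: (@le_hausdorff_measure _ _ (r0 / 2)); first by rewrite divr_gt0.
apply: le_ereal_inf_tmp => _ [D [B [[HB cov] ->]]]; rewrite leNgt; apply/negP => small.
pose A i := if `[< D i >] then B i else set0.
have lenB i : D i -> 0 <= len (B i) <= r0 / 2 by move=> /HB[_ ->]; rewrite len_ge0.
(* The errors [1 / 2 ^ i.+1] add up to 1, whence the bound [C + 1]. *)
have /choice[lam lamP] (i : nat) : exists y : R, [/\ 0 < y < r0,
    D i -> len (B i) < y & D i -> f y <= f (len (B i)) + 1 / (2 ^ i.+1)%:R].
  have [Di|nDi] := pselect (D i); last first.
    by exists (r0 / 2); split => //; apply/andP; split; lra.
  have /andP[h1 h2] := lenB i Di.
  have e0 : 0 < 1 / (2 ^ i.+1)%:R :> R by rewrite divr_gt0// ltr0n expn_gt0.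
  have [y [/andP[y1 y2] fy]] := right_continuous fcont h1 (divr_gt0 r00 (ltr0n _ 2)) e0.
  by exists y; split => // [|_]; [apply/andP; split; lra|exact: ltW].
have lam0 i : 0 < lam i by have [/andP[]] := lamP i.
have diam i x y : A i x -> A i y -> `|x - y| <= lam i.
  rewrite /A; case: asboolP => // Di Bx By.
  have [dB _] := HB i Di; have [_ /(_ Di)/ltW h _] := lamP i.
  by apply: le_trans h; exact: direction_interval_diam.
have fl0 i : 0 <= f (lam i) by apply/f_ge0/ltW.
have loadf : (load A (f \o lam) (- (pi / 4)) (pi / 4) <= (C + 1)%:E)%E.
  pose a i := (if `[< D i >] then (f (len (B i)))%:E else 0%:E)%E.
  have a0 i : (0 <= a i)%E.
    by rewrite /a; case: asboolP => // _; rewrite lee_fin f_ge0// len_ge0.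
  apply: (@le_trans _ _ (\sum_(i <oo) (a i + (1 / (2 ^ i.+1)%:R)%:E))%E).
    apply: lee_nneseries => [i _ _|i _]; first by apply: load_term_ge0; exact: fl0.
    rewrite /a; case: ifPn => [|_]; last first.
      by apply: adde_ge0 (a0 i) _; rewrite lee_fin divr_ge0.
    move=> /asboolP[x [Ax _]]; move: Ax; rewrite /A; case: asboolP => // Di _.
    by rewrite -EFinD lee_fin; have [_ _ /(_ Di)] := lamP i.
  apply: le_trans (epsilon_trick _ a0 ler01) _.
  rewrite EFinD leeD2r// ltW//; move: small; rewrite esum_nneseries//.
  by move=> i _; rewrite lee_fin f_ge0// len_ge0.
have [] := escape_cover kappa0 kappa1 f0 fi fbig fd l0 psi0 kgb lam0 diam _ _ _ _ loadf; [lra|lra|lra| |].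
  have -> : ((kappa / 16 * (pi / 4 - - (pi / 4)))%:E = q^-1%:E * (C + 1)%:E)%E.
    rewrite -EFinM; congr _%:E; rewrite -/J /q invf_div divfK// gt_eqF//; lra.
  apply: le_trans (lee_wpmul2l _ loadf); last by rewrite lee_fin invr_ge0 ltW.
  rewrite /load -nneseriesZl; last by move=> i _; apply: load_term_ge0; exact: fl0.
  apply: lee_nneseries => [i _ _|i _]; first by apply: load_term_ge0; exact: ltW.
  rewrite -EFinM lee_fin; case: ifPn => [_|_]; last by rewrite mulr0.
  have [/andP[y1 y2] _ _] := lamP i.
  by rewrite mulrC ler_pdivlMr// mulrC; exact: fr0.
move=> x /cov[i Di Bx] /(_ i); apply; rewrite /A; by case: asboolP.
Qed.

End Hausdorff.

(** * Convergence *)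

Section Convergence.
Context {R : realType}.
Implicit Types (S E : set R) (l phi f psi : R -> R).

(** The cover is transported along an injection [g] of [I] into [nat]; for [n] in the image, [B' n]
    is a union over a single index. *)
Lemma hausdorff_content_countable_cover f (rho : R) E (T : choiceType) (I : set T)
    (B : T -> set R) : (forall r : R, 0 <= r -> 0 <= f r) -> countable I ->
  (forall t, I t -> direction_interval (B t) /\ len (B t) <= rho) ->
  E `<=` \bigcup_(t in I) B t ->
  (hausdorff_content f rho E <= \esum_(t in I) (f (len (B t)))%:E)%E.
Proof.
move=> f_ge0 /countable_injP[g ginj] HB cov.
pose B' n := \bigcup_(t in [set t | I t /\ g t = n]) B t.
have B'E t : I t -> B' (g t) = B t.
  move=> It; apply/seteqP; split => x; last by exists t.
  by move=> [s [Is /ginj st]] Bx; rewrite -st ?inE.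
have -> : \esum_(t in I) (f (len (B t)))%:E = \esum_(n in g @` I) (f (len (B' n)))%:E.
  rewrite (@reindex_esum _ _ _ I (g @` I) g); first by apply: eq_esum => t It; rewrite B'E.
  by apply: inj_bij => //; exact: ginj.
apply: ereal_inf_lbound; exists (g @` I), B'; split => //; split.
  by move=> _ [t It <-]; rewrite B'E//; exact: HB.
by move=> x /cov[t It Bx]; exists (g t); [exists t|rewrite B'E].
Qed.

(* The winding number is [k - 1], for [k] in {0, 1, 2}. *)
Definition ball_piece (t r : R) (k : nat) : set R :=
  directions `&` `]t + (k%:R - 1) * pi - r, t + (k%:R - 1) * pi + r[.

(** Two directions differ by less than [pi], so the winding number [k] has
    [|k| * pi < 3 / 2 * pi]. *)
Lemma direction_ball_pieces (t r : R) : directions t -> r <= pi / 2 ->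
  direction_ball t r `<=` \bigcup_(k in `I_3) ball_piece t r k.
Proof.
rewrite /directions /= in_itv /= => /andP[t1 t2] rpi x [dx [k kx]].
have pi0 := pi_gt0 R.
have := dx; rewrite /directions /= in_itv /= => /andP[x1 x2].
have [h1 h2] : k%:~R * (pi : R) < 2 * pi /\ - 2 * pi < k%:~R * (pi : R).
  by move: kx; rewrite ltr_norml => /andP[? ?]; split; lra.
rewrite ltr_pM2r// in h1; rewrite ltr_pM2r// in h2.
have [j j3 jk] : exists2 j : nat, (j < 3)%N & k%:~R = j%:R - 1 :> R.
  have {}h1 : (k < 2)%R by rewrite -(ltr_int R).
  have {}h2 : (- 2 < k)%R by rewrite -(ltr_int R) mulrNz.
  have [->|[->|->]] : k = -1 \/ k = 0 \/ k = 1 by lia.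
  - by exists 0%N => //; rewrite mulrNz sub0r.
  - by exists 1%N => //; rewrite subrr.
  - by exists 2%N => //; lra.
exists j => //; split => //; rewrite -jk /= in_itv /=.
by move: kx; rewrite ltr_norml => /andP[? ?]; apply/andP; split; lra.
Qed.

Lemma ball_piece_interval (t r : R) k : direction_interval (ball_piece t r k).
Proof.
split; last by move=> x [].
move=> x y [dx ix] [dy iy] z xyz; split.
  exact: (@interval_is_interval _ `[- (pi / 2), pi / 2[) dx dy z xyz.
exact: (@interval_is_interval _ `]_, _[) ix iy z xyz.
Qed.

Lemma len_ball_piece (t r : R) k : 0 <= r -> len (ball_piece t r k) <= 2 * r.
Proof.
move=> r0; have dB := ball_piece_interval t r k.
rewrite -lee_fin -lenE; [|exact: direction_interval_measurable|exact: dB.2].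
set c := t + (k%:R - 1) * pi.
have -> : 2 * r = (c + r) - (c - r) by lra.
rewrite -lebesgue_measure_oo; last lra.
apply: le_measure; rewrite ?inE; last by move=> x [].
  exact: direction_interval_measurable.
exact: measurable_itv.
Qed.

(** The shifted ends leave [2 ^ j] terms, all with [2 ^ j < n <= 2 ^ j.+1], so that [phi] at the
    right end bounds each from below. *)
Lemma dyadic_block phi (j : nat) :
  (forall r s : R, 0 < r -> r <= s -> phi s <= phi r) ->
  (forall r : R, 0 < r -> 0 <= phi r) ->
  (2 ^+ j) ^+ 2 * phi (2 ^+ j.+1) <=
  \sum_((2 ^ j).+1 <= n < (2 ^ j.+1).+1) n%:R * phi n%:R.
Proof.
move=> phid phi0.
apply: (@le_trans _ _ (\sum_((2 ^ j).+1 <= n < (2 ^ j.+1).+1) 2 ^+ j * phi (2 ^+ j.+1))).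
  rewrite sumr_const_nat subSS expnS mul2n -addnn addnK -[leRHS]mulr_natr natrX.
  by rewrite [leRHS]mulrAC -expr2.
apply: ler_sum_nat => n /andP[n1 n2].
have n0 : 0 < n%:R :> R by rewrite ltr0n (leq_trans _ n1).
apply: ler_pM => //; first by apply: phi0; exact: exprn_gt0.
  by rewrite -natrX ler_nat ltnW.
by apply: phid => //; rewrite -natrX ler_nat.
Qed.

(** Lengths in []2 ^ j.+1, 2 ^ j.+2]] occur at most [M * (2 ^ j.+2) ^ 2] times, that is
    [16 * M * (2 ^ j) ^ 2], and [dyadic_block] absorbs [(2 ^ j) ^ 2 * phi (2 ^ j.+1)]. *)
Lemma dyadic_sum S l phi (M : R) (p N : nat) (s : seq R) : 0 < M ->
  (forall r : R, 0 < r ->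
      (counting [set t | S t /\ (l t <= r)%R] <= (M * r ^+ 2)%:E)%E) ->
  (forall r s : R, 0 < r -> r <= s -> phi s <= phi r) ->
  (forall r : R, 0 < r -> 0 <= phi r) ->
  uniq s -> (forall t, t \in s -> S t /\ 2 ^+ p.+1 < l t <= 2 ^+ (p + N).+1) ->
  \sum_(t <- s) phi (l t) <=
    16 * M * \sum_((2 ^ p).+1 <= n < (2 ^ (p + N)).+1) n%:R * phi n%:R.
Proof.
move=> M0 cnt phid phi0; elim: N s => [|N IH] s us sP.
  case: s {us} sP => [_|t s /(_ t (mem_head _ _))[_]]; last first.
    by rewrite addn0 => /andP[/lt_le_trans h /h]; rewrite ltxx.
  by rewrite big_nil addn0 big_geq// mulr0.
rewrite (bigID (fun t => l t <= 2 ^+ (p + N).+1)) /=.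
rewrite (@big_cat_nat _ _ _ (2 ^ (p + N)).+1)/=; last 2 first.
  by rewrite ltnS leq_exp2l// leq_addr.
  by rewrite ltnS leq_exp2l// addnS.
rewrite mulrDr; apply: lerD.
  rewrite -big_filter; apply: IH; first exact: filter_uniq.
  by move=> t; rewrite mem_filter => /andP[h /sP[St /andP[-> _]]].
pose s' := [seq t <- s | ~~ (l t <= 2 ^+ (p + N).+1)].
rewrite -big_filter -/s'.
have s'P t : t \in s' -> S t /\ 2 ^+ (p + N).+1 < l t <= 2 ^+ (p + N).+2.
  rewrite mem_filter -ltNge => /andP[-> /sP[St /andP[_]]]; rewrite addnS => ->; by split.
apply: (@le_trans _ _ (\sum_(t <- s') phi (2 ^+ (p + N).+1))).
  rewrite [leLHS]big_seq [leRHS]big_seq; apply: ler_sum => t /s'P[_ /andP[h _]].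
  by apply: phid; [exact: exprn_gt0|exact: ltW].
rewrite sumr_const_seq addnS.
have size_s' : (size s')%:R <= M * (2 ^+ (p + N).+2) ^+ 2.
  apply: (size_le_counting (A := [set t | S t /\ l t <= 2 ^+ (p + N).+2])).
  - exact: filter_uniq.
  - by move=> t /s'P[? /andP[_ ?]].
  - by apply: cnt; exact: exprn_gt0.
have phi00 : 0 <= phi (2 ^+ (p + N).+1) by apply: phi0; exact: exprn_gt0.
apply: le_trans (ler_wpM2r phi00 size_s') _.
have h : 0 <= 16 * M by lra.
apply: le_trans (ler_wpM2l h (dyadic_block (p + N) phid phi0)).
by rewrite !exprS; lra.
Qed.

Lemma summable_tail phi (e : R) : 0 < e -> (forall r : R, 0 < r -> 0 <= phi r) ->
  (\sum_(1 <= n <oo) (n%:R * phi n%:R)%:E < +oo)%E ->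
  exists p0 : nat, forall p m : nat, (p0 <= p)%N -> \sum_(p <= n < m) n%:R * phi n%:R <= e.
Proof.
move=> e0 phi0 fin.
have t0 n : (0 <= (n%:R * phi n%:R)%:E)%E.
  case: n => [|n]; first by rewrite mul0r.
  by rewrite lee_fin mulr_ge0// phi0// ltr0n.
have fin0 : (\sum_(0 <= n <oo) (n%:R * phi n%:R)%:E < +oo)%E.
  rewrite (@nneseries_split _ _ 0 1); last by move=> *; exact: t0.
  by rewrite add0n big_nat1 mul0r add0e.
have /fine_cvgP[tfin /cvgrPdist_lt /(_ _ e0) tlt] :=
  nneseries_tail_cvg fin0 (fun k _ => t0 k).
have [p0 _ H] := filterI tfin tlt; exists p0 => p m /H[/= tf].
rewrite sub0r normrN => tp; rewrite -lee_fin -sumEFin.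
apply: (@le_trans _ _ (\sum_(p <= k <oo) (k%:R * phi k%:R)%:E)%E).
  by apply: nneseries_lim_ge => *; exact: t0.
by rewrite -(fineK tf) lee_fin (le_trans (ler_norm _))// ltW.
Qed.

(** The cover consists of the balls with [2 ^ p.+1 < l t], each cut into three intervals whose
    [f]-size is bounded through doubling. *)
Lemma hausdorff_measure_limsup_0 S l psi f :
  planar_resonant_set S l -> quadratic_growth S l ->
  approximation_function psi -> dimension_function f -> f 0 = 0 ->
  (forall r : R, 0 <= r -> f (2 * r) <= 2 * f r) ->
  (forall e : R, 0 < e -> exists2 L : R, 0 < L & psi L < e) ->
  (\sum_(1 <= n <oo) (n%:R * f (psi n%:R))%:E < +oo)%E ->
  hausdorff_measure f (limsup_set S l psi) = 0%E.
Proof.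
move=> resS [M M0 cnt] [psi0 psid] [f_ge0 _ fi _] f0 doubling psi_small fin.
have pi0 := pi_gt0 R.
pose phi r := f (psi r).
have phi0 r : 0 < r -> 0 <= phi r by move=> r0; apply/f_ge0/psi0.
have phid r s : 0 < r -> r <= s -> phi s <= phi r.
  move=> r0 rs; apply: fi; last exact: psid.
  by apply: psi0; exact: lt_le_trans rs.
apply/eqP; rewrite eq_le; apply/andP; split; last first.
  rewrite -[leLHS]/(0%:E); apply: (@le_hausdorff_measure _ _ _ 1) => //.
  apply: le_ereal_inf_tmp => _ [D [B [_ ->]]]; apply: esum_ge0 => i _.
  by rewrite lee_fin f_ge0// len_ge0.
apply: hausdorff_measure_le => rho rho0; apply/lee_addgt0Pr => e e0; rewrite add0e.
(* [pi / 2] allows the cut into three pieces, [rho / 2] makes their lengths at most [rho]. *)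
have m0 : 0 < Num.min (pi / 2) (rho / 2) by rewrite lt_min !divr_gt0.
have [L L0 psiL] := psi_small _ m0.
(* 6 is three pieces times the doubling factor 2; [16 * M] comes from [dyadic_sum]. *)
have e'0 : 0 < e / 6 / (16 * M) by rewrite !divr_gt0// mulr_gt0.
have [p0 tl] := summable_tail e'0 phi0 fin.
pose p := maxn p0 (Num.truncn L).+1.
have pL : L <= 2 ^+ p.+1.
  apply: ltW; apply: lt_trans (truncnS_gt L) _; rewrite -natrX ltr_nat.
  apply: leq_ltn_trans (leq_maxr p0 _) _; apply: ltnW; exact: ltn_expl.
pose I := [set t | S t /\ 2 ^+ p.+1 < l t].
have psiI t : I t -> [/\ 0 <= psi (l t), psi (l t) <= pi / 2 & psi (l t) <= rho / 2].
  move=> [St lt]; have l0 := resonant_length_gt0 resS St.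
  have : psi (l t) <= psi L by apply: psid => //; exact: le_trans (ltW lt).
  move=> h; have := le_lt_trans h psiL; rewrite lt_min => /andP[/ltW ? /ltW ?].
  by split => //; exact: psi0.
pose B (u : R * nat) := ball_piece u.1 (psi (l u.1)) u.2.
pose II : set (R * nat) := I `*`` (fun=> `I_3).
have cII : countable II.
  apply: (@countableX _ _ I `I_3).
  by apply: sub_countable (resonant_countable resS); apply: subset_card_le => t [].
  exact: countableP.
apply: (@le_trans _ _ (\esum_(u in II) (f (len (B u)))%:E)).
  apply: hausdorff_content_countable_cover => //.
    move=> u [/psiI[h1 h2 h3] _]; split; first exact: ball_piece_interval.
    by apply: le_trans (len_ball_piece _ _ h1) _; lra.
  move=> x Wx; have [|t It tx] := Wx (2 ^+ p.+1); first exact: exprn_gt0.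
  have [_ ht _] := psiI t It.
  have [k k3 xk] := direction_ball_pieces (resonant_directions resS It.1) ht tx.
  by exists (t, k).
apply: (@le_trans _ _ (\esum_(u in II) (2 * phi (l u.1))%:E)).
  apply: le_esum => u [/psiI[h1 _ _] _]; rewrite lee_fin.
  by apply: le_trans (doubling _ h1); apply: fi; [exact: len_ge0|exact: len_ball_piece].
have phil t : I t -> 0 <= phi (l t) by move=> [St _]; apply/phi0/(resonant_length_gt0 resS St).
rewrite -(@esum_esum _ _ _ I (fun=> `I_3) (fun t k => (2 * phi (l t))%:E)); last first.
  by move=> t k /phil h _; rewrite lee_fin mulr_ge0.
apply: (@le_trans _ _ (\esum_(t in I) (6 * phi (l t))%:E)).
  apply: le_esum => t It; rewrite esum_fset; last 2 first.
  - exact: finite_II.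
  - by move=> k _; rewrite lee_fin mulr_ge0// phil.
  by rewrite -fsbig_ord !big_ord_recr big_ord0 /= add0e -!EFinD lee_fin; lra.
apply: ub_ereal_sup => _ [X [finX XI] <-].
rewrite fsbig_finite//= sumEFin lee_fin -mulr_sumr.
set s := finmap.enum_fset _.
have sI t : t \in s -> I t.
  by move=> ts; apply: XI; rewrite -(fset_setK finX).
(* Finitely many resonances have bounded lengths, as [dyadic_sum] requires; the final estimate does
   not depend on [N]. *)
have [N lN] : exists N : nat, forall t, t \in s -> l t <= 2 ^+ (p + N).+1.
  elim: s {sI} => [|t s [N IH]]; first by exists 0%N.
  exists (maxn N (Num.truncn (l t)).+1) => u; rewrite inE => /predU1P[->|/IH h].
    apply: ltW; apply: lt_trans (truncnS_gt _) _; rewrite -natrX ltr_nat.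
    apply: leq_ltn_trans (leq_maxr N _) _; apply: leq_ltn_trans (leq_addl p _) _.
    by apply: ltnW; exact: ltn_expl.
  apply: le_trans h _; rewrite -!natrX ler_nat leq_exp2l// ltnS leq_add2l.
  exact: leq_maxl.
have us : uniq s by exact: finmap.fset_uniq.
have := dyadic_sum M0 cnt phid phi0 us (N := N) (p := p).
have p0p : (p0 <= (2 ^ p).+1)%N.
  apply: leq_trans (leq_maxl p0 (Num.truncn L).+1) _; apply: ltnW; apply: ltnW.
  by rewrite ltnS; exact: ltn_expl.
have := tl _ (2 ^ (p + N)).+1 p0p.
rewrite ler_pdivlMr ?mulr_gt0//.
move=> h1 h2; have {h2} := h2 _; move=> h2.
have : \sum_(t <- s) phi (l t) <= 16 * M * \sum_((2 ^ p).+1 <= n < (2 ^ (p + N)).+1) n%:R * phi n%:R.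
  by apply: h2 => t ts; have [St lt] := sI t ts; rewrite lt lN.
by rewrite /phi in h1 *; lra.
Qed.

End Convergence.

(** * The case of Lebesgue measure *)

Section LebesgueCase.
Context {R : realType}.
Implicit Types (S E : set R) (l psi f : R -> R).

(* By the density theorem: no point of the complement of [U] can be a point of
   density of this complement. *)
Lemma full_measure_of_uniform_density (U : set R) (kappa : R) : measurable U -> 0 < kappa ->
  (forall al be : R, al < be -> - (pi / 2) <= al -> be <= pi / 2 ->
    ((kappa * (be - al))%:E <= lebesgue_measure (U `&` `]al, be[))%E) ->
  lebesgue_measure (directions `\` U) = 0%E.
Proof.
move=> mU kappa0 H; set C := directions `\` U.
have mC : measurable C by apply: measurableD => //; exact: measurable_directions.
have [N [mN N0 CN]] := lebesgue_density mC.
(* The endpoint [- (pi / 2)] has no two-sided neighbourhood inside [directions] and is put aside as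
   a null set. *)
apply/eqP; rewrite eq_le measure_ge0 andbT; pose P : set R := [set - (pi / 2)].
apply: (@le_trans _ _ (lebesgue_measure (N `|` P))).
  apply: le_measure; rewrite ?inE//; first by apply: measurableU => //; exact: measurable_set1.
  suff sub (x : R) : C x -> (N `|` P) x by exact: sub.
  move=> Cx; have [->|xpi] := eqVneq x (- (pi / 2)); [by right|left].
  apply: CN => /=; rewrite indicE mem_set// => cvg1.
  have [+ _] := Cx; rewrite /directions /= in_itv /= => /andP[x1 x2].
  have {}x1 : - (pi / 2) < x by rewrite lt_def xpi.
  (* The density 1 at [x] would be a limit of ratios bounded by [1 - kappa]. *)
  have : (1%:E <= (1 - kappa)%:E :> \bar R)%E.
    apply: cvge_to_le cvg1 _; near=> r.
    have r0 : 0 < r by near: r; exact: nbhs_right_gt.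
    have rx1 : r < x - - (pi / 2) by near: r; apply: nbhs_right_lt; rewrite subr_gt0.
    have rx2 : r < pi / 2 - x by near: r; apply: nbhs_right_lt; rewrite subr_gt0.
    have r2 : 0 < 2 * r by lra.
    rewrite ball_itv.
    pose I : set R := `]x - r, x + r[%classic.
    have mI : measurable I by exact: measurable_itv.
    have lenI : lebesgue_measure I = (2 * r)%:E.
      by rewrite /I lebesgue_measure_oo; [congr _%:E|]; lra.
    have CI : (lebesgue_measure (C `&` I) <= lebesgue_measure (I `\` U))%E.
      apply: le_measure; rewrite ?inE; [exact: measurableI|exact: measurableD|].
      by move=> y [[_ Uy] Iy].
    have UI := H (x - r) (x + r) ltac:(lra) ltac:(lra) ltac:(lra).
    have bound : (lebesgue_measure (C `&` I) <= ((1 - kappa) * (2 * r))%:E)%E.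
      have := lebesgue_measureDI mI mU; rewrite lenI setIC => Isplit.
      apply: le_trans CI _; move: UI Isplit; rewrite -/I.
      have -> : x + r - (x - r) = 2 * r by lra.
      move: (lebesgue_measure (I `\` U)) (lebesgue_measure (U `&` I)).
      by move=> [a||] [b||] //=; rewrite ?lee_fin// -EFinD => h1 [h2]; lra.
    have ratio : (lebesgue_measure (C `&` I) / lebesgue_measure I <= (1 - kappa)%:E)%E.
      by rewrite lenI inver gt_eqF// lee_pdivrMr// -EFinM.
    exact: ratio.
  rewrite lee_fin; lra.
have : (lebesgue_measure (N `|` P) <= lebesgue_measure N + lebesgue_measure P)%E.
  by apply: measureU2 => //; exact: measurable_set1.
by rewrite N0 lebesgue_measure_set1 adde0.
Unshelve. all: by end_near. Qed.

(** Each [U n] fills a fixed proportion of every interval, hence has full measure, and so has the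
    countable intersection over integer bounds. *)
Lemma limsup_set_full S l psi (kappa : R) : planar_resonant_set S l -> 0 < kappa ->
  fills_intervals S l psi kappa ->
  exists2 W, measurable W & W `<=` limsup_set S l psi /\ lebesgue_measure W = (pi%:E : \bar R).
Proof.
move=> resS kappa0 kgb.
pose U (n : nat) := \bigcup_(t in [set t | S t /\ n%:R < l t]) direction_ball t (psi (l t)).
have mU n : measurable (U n).
  rewrite /U; under eq_bigcupr do rewrite direction_ballE.
  rewrite -setI_bigcupr; apply: measurableI; first exact: measurable_directions.
  apply: measurable_realfun.open_measurable; apply: bigcup_open => t _.
  apply: bigcup_open => k _; exact: ball_open.
have Ufull n : lebesgue_measure (directions `\` U n) = 0%E.
  apply: (@full_measure_of_uniform_density _ (2 * kappa)) => //; first by rewrite mulr_gt0.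
  move=> al be albe alpi bepi.
  have [F [sF FP Fbig]] := kgb al be n%:R 1 albe alpi bepi ltr01.
  apply: (@le_trans _ _ (\sum_(u <- F) 2 * u.2)%:E).
    by rewrite lee_fin -mulr_sumr -mulrA ler_pM2l.
  apply: lebesgue_measure_packing => //.
    by apply: measurableI => //; exact: measurable_itv.
  move=> u /FP[Su nl /andP[/ltW u0 _] upsi [h1 h2]]; split => // x.
  rewrite /= in_itv /= => /andP[x1 x2]; split; last first.
    by rewrite /= in_itv /=; apply/andP; split; lra.
  exists u.1 => //; apply: direction_ball_near.
    by rewrite /directions /= in_itv /=; apply/andP; split; lra.
  by rewrite ltr_norml; apply/andP; split; lra.
pose W := directions `&` \bigcap_n U n.
have mW : measurable W.
  by apply: measurableI; [exact: measurable_directions|exact: bigcapT_measurable].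
exists W => //; split.
  move=> x [dx Ux] L L0; have [t [St nt] tx] := Ux (Num.truncn L).+1 I.
  by exists t => //; split => //; apply: lt_trans nt; exact: truncnS_gt.
rewrite -lebesgue_measure_directions (lebesgue_measureDI measurable_directions mW).
have -> : directions `&` W = W by rewrite /W setIA setIid.
suff -> : lebesgue_measure (directions `\` W) = 0%E by rewrite add0e.
apply/eqP; rewrite eq_le measure_ge0 andbT.
have -> : directions `\` W = \bigcup_n (directions `\` U n).
  apply/seteqP; split => [x [dx nW]|x [n _ [dx nU]]]; last first.
    by split => // -[_ Ux]; exact: nU (Ux n I).
  apply: contrapT => nU; apply: nW; split => // n _; apply: contrapT => nUn.
  by apply: nU; exists n.
apply: (@le_trans _ _ (\sum_(n <oo) lebesgue_measure (directions `\` U n))%E).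
  have mD n : measurable (directions `\` U n).
    by apply: measurableD => //; exact: measurable_directions.
  by apply: generalized_Boole_inequality => //; exact: bigcupT_measurable.
by rewrite eseries0// => n _ _; exact: Ufull.
Qed.

Lemma hausdorff_measure_directions_le f : (forall r : R, 0 <= r -> f r = r) ->
  (hausdorff_measure f (directions : set R) <= pi%:E)%E.
Proof.
move=> fid; have pi0 := pi_gt0 R; apply: hausdorff_measure_le => rho rho0.
pose N := (Num.truncn ((pi : R) / rho)).+1.
have N0 : 0 < N%:R :> R by rewrite ltr0n.
pose d : R := pi / N%:R; have d0 : 0 < d by rewrite divr_gt0.
have dN : d * N%:R = pi by rewrite divfK// gt_eqF.
have drho : d <= rho.
  rewrite /d ler_pdivrMr// -ler_pdivrMl// mulrC; apply/ltW; exact: truncnS_gt.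
pose B (i : nat) : set R := `[- (pi / 2) + i%:R * d, - (pi / 2) + i.+1%:R * d[%classic.
have lenB i : len (B i) = d.
  rewrite /len /B; have -> := @lebesgue_measure_itv R `[- (pi / 2) + i%:R * d, - (pi / 2) + i.+1%:R * d[.
  rewrite /= lte_fin -[i.+1%:R]natr1 ifT /=; lra.
apply: ereal_inf_le.
exists (\esum_(i in `I_N) (f (len (B i)))%:E)%E.
  exists `I_N, B; split => //; split; last first.
    move=> x; rewrite /directions /= in_itv /= => /andP[x1 x2].
    have x0 : 0 <= (x + pi / 2) / d by rewrite divr_ge0//; lra.
    have := truncn_itv x0; rewrite ler_pdivlMr// ltr_pdivrMr// => /andP[h1 h2].
    exists (Num.truncn ((x + pi / 2) / d)).
      rewrite /= -(ltr_nat R) -(ltr_pM2r d0); lra.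
    by rewrite /B /= in_itv /=; apply/andP; split; lra.
  move=> i iN; split; last by rewrite lenB.
  split; first exact: interval_is_interval.
  move=> x; rewrite /B /directions /= !in_itv /= => /andP[x1 x2].
  have h1 : 0 <= i%:R * d by rewrite mulr_ge0// ltW.
  have h2 : i.+1%:R * d <= d * N%:R by rewrite mulrC ler_pM2l// ler_nat.
  by apply/andP; split; lra.
rewrite esum_fset//; last by move=> i _; rewrite lenB lee_fin fid ltW.
rewrite -fsbig_ord sumEFin lee_fin.
under eq_bigr do rewrite lenB fid ?ltW//.
by rewrite sumr_const card_ord -mulr_natr dN.
Qed.

Lemma lebesgue_le_hausdorff_content f (rho : R) E W : (forall r : R, 0 <= r -> f r = r) ->
  measurable W -> W `<=` E -> (lebesgue_measure W <= hausdorff_content f rho E)%E.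
Proof.
move=> fid mW WE; apply: le_ereal_inf_tmp => _ [D [B [[HB cov] ->]]].
rewrite esum_nneseries; last by move=> i _; rewrite lee_fin fid len_ge0.
pose B' i := if `[< D i >] then B i else set0.
have mB' i : measurable (B' i).
  by rewrite /B'; case: asboolP => // /HB[/direction_interval_measurable].
apply: (@le_trans _ _ (\sum_(i <oo) lebesgue_measure (B' i))%E).
  apply: measure_sigma_subadditive => // x /WE/cov[i Di Bx]; exists i => //.
  by rewrite /B'; case: asboolP.
apply: lee_nneseries => // i _; rewrite /B'; case: asboolP => [Di|_]; last by rewrite measure0.
have [dB _] := HB i Di.
by rewrite lenE ?fid ?len_ge0//; [exact: direction_interval_measurable|exact: dB.2].
Qed.

End LebesgueCase.

(** * Dimension functions *)

Section DimensionFunctions.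
Context {R : realType}.
Implicit Types (f psi : R -> R).

(** Otherwise [s * f (psi s) >= s * f 0] would be unbounded, yet for [s >= 1] it is at most
    [f (psi 1)]. *)
Lemma dimension_function_0 f psi : approximation_function psi -> dimension_function f ->
  (forall r s : R, 0 < r -> r <= s -> s * f (psi s) <= r * f (psi r)) -> f 0 = 0.
Proof.
move=> [psi0 _] [f_ge0 _ fi _] decr; apply/eqP; rewrite eq_le f_ge0// andbT leNgt.
apply/negP => f00; pose C := f (psi 1).
have C0 : 0 <= C / f 0 by rewrite divr_ge0 ?f_ge0 ?psi0.
pose s := C / f 0 + 1; have s1 : 1 <= s by rewrite /s lerDr.
have s0 : 0 < s by exact: lt_le_trans s1.
have := decr 1 s ltr01 s1; rewrite mul1r -/C => h.
have : s * f 0 <= s * f (psi s) by rewrite ler_pM2l// fi// psi0.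
by rewrite /s mulrDl divfK ?gt_eqF// mul1r -/s; lra.
Qed.

Lemma dimension_function_superlinear f : (f r / r @[r --> 0^'+] --> +oo) ->
  superlinear_at0 f.
Proof.
move=> /cvgryPge + q; move=> /(_ q) [r0 /= r00 H]; exists r0 => // r r1 r2.
by rewrite -ler_pdivlMr//; apply: H => //=; rewrite sub0r normrN gtr0_norm.
Qed.

Lemma dimension_function_gt0 f : dimension_function f -> forall r : R, 0 < r -> 0 < f r.
Proof.
move=> [_ _ fi [[_ /dimension_function_superlinear fbig]|fid]] r r0.
  exact: superlinear_gt0 fi fbig r r0.
by rewrite fid// ltW.
Qed.

Lemma dimension_function_doubling f : dimension_function f -> f 0 = 0 ->
  forall r : R, 0 <= r -> f (2 * r) <= 2 * f r.
Proof.
move=> [_ _ _ [[fd _]|fid]] f0 r r0; last by rewrite !fid//; lra.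
move: r0; rewrite le_eqVlt => /predU1P[<-|r0]; first by rewrite mulr0 f0 mulr0.
have := fd r (2 * r) r0 ltac:(lra).
rewrite ler_pdivrMr; last lra.
by have -> : 2 * f r = f r / r * (2 * r) by field; rewrite gt_eqF.
Qed.

(** If [psi] stayed at least [e], then [s * f (psi s) >= s * f e] would be unbounded, as [f e] is
    positive. *)
Lemma approximation_vanishes f psi : approximation_function psi -> dimension_function f ->
  (forall r s : R, 0 < r -> r <= s -> s * f (psi s) <= r * f (psi r)) ->
  forall e : R, 0 < e -> exists2 L : R, 0 < L & psi L < e.
Proof.
move=> [psi0 _] dimf decr e e0; have [f_ge0 _ fi _] := dimf.
have fe0 := dimension_function_gt0 dimf e0.
pose C := f (psi 1).
have C0 : 0 <= C / f e by rewrite divr_ge0 ?f_ge0 ?psi0// ltW.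
pose s := C / f e + 1; have s1 : 1 <= s by rewrite /s lerDr.
have s0 : 0 < s by exact: lt_le_trans s1.
exists s => //; rewrite ltNge; apply/negP => psis.
have := decr 1 s ltr01 s1; rewrite mul1r -/C => h.
have : s * f e <= s * f (psi s) by rewrite ler_pM2l// fi// ltW.
by rewrite /s mulrDl divfK ?gt_eqF// mul1r -/s; lra.
Qed.

End DimensionFunctions.

(** * Convergence and divergence statements *)

Theorem theorem1p7 (R : realType) (S : set R) (l psi f : R -> R)
    (resS : planar_resonant_set S l)
    (growthS : quadratic_growth S l)
    (approx_psi : approximation_function psi)
    (dim_f : dimension_function f)
    (decr : forall r s : R, 0 < r -> r <= s ->
       s * f (psi s) <= r * f (psi r)) :
  ((\sum_(1 <= n <oo) (n%:R * f (psi n%:R))%:E < +oo)%E ->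
     hausdorff_measure f (limsup_set S l psi) = 0%E) /\
  ((\sum_(1 <= n <oo) (n%:R * f (psi n%:R))%:E = +oo)%E ->
     ubiquitous S l -> isotropic_quadratic_growth S l ->
     hausdorff_measure f (limsup_set S l psi) =
     hausdorff_measure f directions).
Proof.
have f0 := dimension_function_0 approx_psi dim_f decr.
split.
  apply: hausdorff_measure_limsup_0 => //.
    exact: dimension_function_doubling.
  exact: approximation_vanishes decr.
move=> div ubi iso.
have [psi0 psid] := approx_psi; have [f_ge0 _ fi growth] := dim_f.
have phi0 (r : R) : 0 < r -> 0 <= f (psi r) by move=> r0; apply/f_ge0/psi0.
have phid (r s : R) : 0 < r -> r <= s -> f (psi s) <= f (psi r).
  move=> r0 rs; apply: fi; last exact: psid.
  by apply: psi0; exact: lt_le_trans rs.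
have [kappa0 kappa00 kgb0] :=
  ubiquitous_fills_intervals (phi := f \o psi) resS ubi iso phi0 phid div.
(* Capping at 1 keeps the load factor [kappa / 16] below 1 in the escape argument. *)
pose kappa := Num.min kappa0 1.
have kappa_gt0 : 0 < kappa by rewrite lt_min kappa00 ltr01.
have kappa_le1 : kappa <= 1 by rewrite ge_min lexx orbT.
have kgb : fills_intervals S l (f \o psi) kappa.
  move=> al be L eta albe alpi bepi eta0; have [F [sF FP Fbig]] := kgb0 al be L eta albe alpi bepi eta0.
  exists F; split => //; apply: le_trans Fbig; rewrite ler_pM2r ?subr_gt0//.
  by rewrite ge_min lexx.
have Wdir : limsup_set S l psi `<=` directions.
  by move=> x Wx; have [|t _ []] := Wx 1; first exact: ltr01.
apply/eqP; rewrite eq_le hausdorff_measure_mono//=.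
have [[fd fcvg]|fid] := growth.
  (* In the superlinear case the limsup set already has infinite measure, so the remaining
     inequality is immediate. *)
  rewrite (hausdorff_measure_pinfty kappa_gt0 kappa_le1 f0 dim_f _ fd _ psi0 kgb) ?leey//.
    exact: dimension_function_superlinear.
  exact: resonant_length_gt0 resS.
have [|W mW [WS WE]] := limsup_set_full resS kappa_gt0 (psi := psi).
  move=> al be L eta albe alpi bepi eta0.
  have [F [sF FP Fbig]] := kgb al be L eta albe alpi bepi eta0.
  exists F; split => // u /FP[Su Lu u0 uf ub]; split => //.
  by move: uf; rewrite /= fid//; apply: psi0; exact: resonant_length_gt0 resS _ Su.
apply: le_trans (hausdorff_measure_directions_le fid) _.
rewrite -WE; apply: (@le_hausdorff_measure _ _ _ 1) => //.
exact: lebesgue_le_hausdorff_content.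
Qed.
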